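(* Let $G$ be an irreducible Artin-Tits group of spherical type, equipped with its classical Garside structure, and let $x_G\in G^0$ be an element satisfying, for some atoms $a,b$ of $G$, properties (i)--(iv) listed in the context. For $N\in\mathbb Z$ let $X^N$ be the vertex $x_G^N\Delta^{\mathbb Z}$ of $\mathcal C_{AL}(G)$, and let $1$ denote the vertex $\Delta^{\mathbb Z}$. Then for any integer $N\in\mathbb Z$, $$d_{AL}\left(1,X^N\right)\geqslant\frac{|N|}{2}.$$
   Context: Artin-Tits groups. A Coxeter matrix is a symmetric matrix $M=(m_{ij})_{1\leqslant i,j\leqslant n}$ of size $n\geqslant 2$ with $m_{ii}=1$, $m_{ij}\in\{2,3,\ldots,\infty\}$ for $i\neq j$, and (standing convention) with at least one off-diagonal $m_{ij}\geqslant 3$. Its Coxeter diagram is the graph with vertices $v_1,\ldots,v_n$ in which $v_i,v_j$ ($i\ne j$) are joined by an edge iff $m_{ij}\geqslant 3$. The Artin-Tits group $A_M$ is generated by $s_1,\ldots,s_n$ with relations $s_is_js_i\cdots=s_js_is_j\cdots$ ($m_{ij}$ alternating terms on each side) for all $i\ne j$ with $m_{ij}<\infty$. The Coxeter group $W_M$ is the quotient of $A_M$ obtained by adding the relations $s_i^2=1$. $A_M$ is of spherical type if $W_M$ is finite; it is irreducible if the Coxeter diagram of $M$ is connected. Classical Garside structure on $G=A_M$. $P$ is the submonoid of $G$ generated by $s_1,\ldots,s_n$ (the atoms). The prefix order $x\preccurlyeq y\Leftrightarrow x^{-1}y\in P$ and the suffix order $x\succcurlyeq y\Leftrightarrow xy^{-1}\in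 P$ are lattice orders. The Garside element $\Delta$ is the least common multiple of all atoms (for either order). Simple elements are the $s$ with $1\preccurlyeq s\preccurlyeq\Delta$. $\tau(x)=\Delta^{-1}x\Delta$, and $o(G)$ is the order of $\tau$. For $x\in G$: $\sup(x)=\min\{k: x\preccurlyeq\Delta^k\}$, $\inf(x)=\max\{k:\Delta^k\preccurlyeq x\}$, $\ell(x)=\sup(x)-\inf(x)$. $G^0=\{x\in G:\inf(x)=0\}$. Normal forms. A pair of simple elements $(s,t)$ is left-weighted if the $\preccurlyeq$-gcd of $s^{-1}\Delta$ and $t$ is $1$, and right-weighted if the $\succcurlyeq$-gcd of $s$ and $\Delta t^{-1}$ is $1$. Each $x$ with $\ell(x)=r\geqslant1$ is uniquely $x=\Delta^{\inf(x)}x_1\cdots x_r$ (left normal form) with $x_i$ simple, $\neq 1$, $x_1\ne\Delta$, consecutive pairs left-weighted; and uniquely $x=x'_r\cdots x'_1\Delta^{\inf(x)}$ (right normal form) with $x'_i$ simple, $\ne 1$, $x'_1\neq\Delta$, consecutive pairs right-weighted. Set $\iota(x)=\tau^{-\inf(x)}(x_1)$, $\varphi(x)=x_r$. The element $x_G$. The properties required of $x_G\in G^0$ and the atoms $a,b$ are: (i) the left and right normal forms of $x_G$ coincide (called the normal form of $x_G$); (ii) $\iota(x_G)=\varphi(x_G)=a$, and the first and last factors of the normal form of $x_G$ are the only ones consisting of a single atom; (iii) the normal form of $x_G$ has two consecutive factors which are respectively $b^{-1}\Delta$ and $\tau(b^{-1})\Delta$; (iv) $\sup(x_G)$ is a multiple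 of $o(G)$. Additional length graph. $y\in G$ is absorbable if ($\inf(y)=0$ or $\sup(y)=0$) and there exists $x\in G$ with $\inf(xy)=\inf(x)$ and $\sup(xy)=\sup(x)$. $\mathcal C_{AL}(G)$ has as vertices the left cosets $g\Delta^{\mathbb Z}$; each vertex $v$ contains a unique element $\underline v\in G^0$. Vertices $v,w$ are joined by an edge iff there is a simple $s\ne1,\Delta$ with $\underline vs\in w$, or an absorbable $y$ with $\underline vy\in w$ (symmetric conditions). Edges have length 1 and $d_{AL}$ is the path metric. *)

(* Defs.v *)
From HB Require Import structures.
From mathcomp Require Import all_boot all_order all_algebra all_classical.

Set Implicit Arguments.
Unset Strict Implicit.
Unset Printing Implicit Defensive.

Import Order.TTheory GRing.Theory Num.Theory.

Local Open Scope classical_set_scope.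
Local Open Scope quotient_scope.
Local Open Scope group_scope.

(* [(i, false)] stands for the generator [i] and [(i, true)] for its formal
   inverse. *)
Definition word (I : choiceType) := seq (I * bool).

Definition letter_inv (I : choiceType) (l : I * bool) : I * bool :=
  (l.1, ~~ l.2).

Definition word_inv (I : choiceType) (w : word I) : word I :=
  rev (map (@letter_inv I) w).

Inductive word_eq (I : choiceType) (R : word I -> word I -> Prop) :
    word I -> word I -> Prop :=
| word_eq_refl u : word_eq R u u
| word_eq_sym u v : word_eq R u v -> word_eq R v u
| word_eq_trans v u w : word_eq R u v -> word_eq R v w -> word_eq R u w
| word_eq_cat u u' v v' :
    word_eq R u u' -> word_eq R v v' -> word_eq R (u ++ v) (u' ++ v')
| word_eq_cancel l : word_eq R [:: l; letter_inv l] [::]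
| word_eq_rel u v : R u v -> word_eq R u v.

Section Presentation.
Variables (I : choiceType) (R : word I -> word I -> Prop).

Definition word_eqb : rel (word I) := fun u v => `[< word_eq R u v >].

Fact word_eqb_refl : reflexive word_eqb.
Proof. by move=> u; apply/asboolP/word_eq_refl. Qed.

Fact word_eqb_sym : symmetric word_eqb.
Proof. by move=> u v; apply/asboolP/asboolP => /word_eq_sym. Qed.

Fact word_eqb_trans : transitive word_eqb.
Proof.
move=> v u w /asboolP uv /asboolP vw; apply/asboolP; exact: word_eq_trans uv vw.
Qed.

Canonical word_equiv :=
  EquivRel word_eqb word_eqb_refl word_eqb_sym word_eqb_trans.

(* The group presented by the generators [I] and the relations [u = v] for
   [R u v]. *)
Definition presented := {eq_quot word_equiv}.
HB.instance Definition _ := Choice.on presented.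

Definition word_class (w : word I) : presented := \pi_presented w.

Definition pr_one : presented := word_class [::].
Definition pr_mul (x y : presented) : presented :=
  word_class (repr x ++ repr y).
Definition pr_inv (x : presented) : presented := word_class (word_inv (repr x)).

Lemma word_classP u v : word_class u = word_class v <-> word_eq R u v.
Proof. by split=> [/eqquotP/asboolP|uv]; last exact/eqquotP/asboolP. Qed.

Lemma word_classK x : word_class (repr x) = x.
Proof. exact: reprK. Qed.

Lemma repr_word_class u : word_eq R (repr (word_class u)) u.
Proof. by apply/word_classP; rewrite word_classK. Qed.

Lemma pr_mulE u v : pr_mul (word_class u) (word_class v) = word_class (u ++ v).
Proof. by apply/word_classP/word_eq_cat; apply: repr_word_class. Qed.

Lemma letter_invK : involutive (@letter_inv I).
Proof. by case=> i e; rewrite /letter_inv /= negbK. Qed.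

Lemma word_invK : involutive (@word_inv I).
Proof.
by move=> w; rewrite /word_inv map_rev revK -map_comp map_id_in // => l _;
   exact: letter_invK.
Qed.

Lemma word_mulV u : word_eq R (u ++ word_inv u) [::].
Proof.
elim: u => [|l u IH]; first exact: word_eq_refl.
rewrite /word_inv map_cons rev_cons -cats1 -/(word_inv u) cat_cons catA.
apply: (word_eq_trans (v := [:: l] ++ ([::] ++ [:: letter_inv l]))).
  rewrite -cat1s; apply: word_eq_cat; first exact: word_eq_refl.
  by apply: word_eq_cat => //; apply: word_eq_refl.
exact: word_eq_cancel.
Qed.

Fact pr_mulA : associative pr_mul.
Proof.
move=> x y z; rewrite -[x]word_classK -[y]word_classK -[z]word_classK.
by rewrite !pr_mulE catA.
Qed.

Fact pr_mul1 : left_id pr_one pr_mul.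
Proof. by move=> x; rewrite -[x]word_classK pr_mulE. Qed.

Fact pr_mulr1 : right_id pr_one pr_mul.
Proof. by move=> x; rewrite -[x]word_classK pr_mulE cats0. Qed.

Fact pr_mulrV : right_inverse pr_one pr_inv pr_mul.
Proof.
move=> x; rewrite -{1}[x]word_classK pr_mulE; exact/word_classP/word_mulV.
Qed.

Fact pr_mulV : left_inverse pr_one pr_inv pr_mul.
Proof.
move=> x; rewrite -{2}[x]word_classK pr_mulE; apply/word_classP.
by rewrite -{2}[repr x]word_invK; apply: word_mulV.
Qed.

HB.instance Definition _ :=
  isGroup.Build presented pr_mulA pr_mul1 pr_mulr1 pr_mulV pr_mulrV.

End Presentation.

(* An entry [None] encodes the value infinity. *)
Record coxeterMatrix (n : nat) := CoxeterMatrix {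
  coxeter_mx :> 'M[option nat]_n;
  coxeter_size : (2 <= n)%N;
  coxeter_sym : forall i j, coxeter_mx i j = coxeter_mx j i;
  coxeter_diag : forall i, coxeter_mx i i = Some 1%N;
  coxeter_offdiag :
    forall i j k, i != j -> coxeter_mx i j = Some k -> (2 <= k)%N;
  coxeter_nontrivial :
    exists i j, i != j /\ (forall k, coxeter_mx i j = Some k -> (3 <= k)%N)
}.

Definition coxeter_edge n (M : coxeterMatrix n) : rel 'I_n :=
  fun i j => (i != j) && (if M i j is Some k then (3 <= k)%N else true).

Definition irreducible n (M : coxeterMatrix n) : Prop :=
  forall i j : 'I_n, connect (coxeter_edge M) i j.

Definition alternating n (i j : 'I_n) (k : nat) : word 'I_n :=
  mkseq (fun l => (if odd l then j else i, false)) k.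

Definition braid_rel n (M : coxeterMatrix n) (u v : word 'I_n) : Prop :=
  exists i j k, [/\ i != j, M i j = Some k,
    u = alternating i j k & v = alternating j i k].

Definition square_rel n (u v : word 'I_n) : Prop :=
  exists i : 'I_n, u = [:: (i, false); (i, false)] /\ v = [::].

Definition artin n (M : coxeterMatrix n) : groupType :=
  presented (braid_rel M).

Definition coxeter_group n (M : coxeterMatrix n) : groupType :=
  presented (fun u v => braid_rel M u v \/ square_rel u v).

Definition spherical n (M : coxeterMatrix n) : Prop :=
  finite_set [set: coxeter_group M].

Definition zpow (G : groupType) (x : G) (k : int) : G :=
  match k with Posz m => x ^+ m | Negz m => x ^- m.+1 end.

Definition is_lub_for T (le : T -> T -> Prop) (A : set T) (d : T) : Prop :=
  (forall a, A a -> le a d) /\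
  (forall e, (forall a, A a -> le a e) -> le d e).

Definition is_gcd_for T (le : T -> T -> Prop) (x y d : T) : Prop :=
  [/\ le d x, le d y & forall e, le e x -> le e y -> le e d].

(* The minimum (maximum) of [A], with the default value [x0] if it does not
   exist. *)
Definition set_min d (T : porderType d) (x0 : T) (A : set T) : T :=
  xget x0 [set x | A x /\ lbound A x].

Definition set_max d (T : porderType d) (x0 : T) (A : set T) : T :=
  xget x0 [set x | A x /\ ubound A x].

Section Garside.
Variables (n : nat) (M : coxeterMatrix n).
Local Notation G := (artin M).

Definition gen (i : 'I_n) : G := word_class (braid_rel M) [:: (i, false)].

Definition atoms : set G := range gen.

Definition positive : set G :=
  [set x | exists w : seq 'I_n, x = \prod_(i <- w) gen i].

Definition pre_le (x y : G) : Prop := positive (x^-1 * y).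

Definition suf_ge (x y : G) : Prop := positive (x * y^-1).

Definition suf_le (x y : G) : Prop := suf_ge y x.

Definition Delta : G :=
  xget 1 [set d | is_lub_for pre_le atoms d /\ is_lub_for suf_le atoms d].

Definition simple (s : G) : Prop := pre_le 1 s /\ pre_le s Delta.

Definition tau (x : G) : G := Delta^-1 * x * Delta.

(* The value is 0 if no positive power of [tau] is the identity. *)
Definition tau_order : nat :=
  set_min 0%N [set k | (0 < k)%N /\ forall x, iter k tau x = x].

Definition gsup (x : G) : int :=
  set_min 0%R [set k : int | pre_le x (zpow Delta k)].

Definition ginf (x : G) : int :=
  set_max 0%R [set k : int | pre_le (zpow Delta k) x].

Definition glen (x : G) : int := (gsup x - ginf x)%R.

Definition left_weighted (s t : G) : Prop :=
  is_gcd_for pre_le (s^-1 * Delta) t 1.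

Definition right_weighted (s t : G) : Prop :=
  is_gcd_for suf_le s (Delta * t^-1) 1.

(* In both normal forms the factors are listed in the order in which they are
   multiplied, so that for the right normal form [x'_1] is the last entry. *)
Definition is_left_nf (x : G) (s : seq G) : Prop :=
  [/\ (size s)%:Z%R = glen x,
      x = zpow Delta (ginf x) * \prod_(y <- s) y,
      forall y, y \in s -> simple y /\ y <> 1,
      head 1 s <> Delta &
      forall i, (i.+1 < size s)%N -> left_weighted s`_i s`_i.+1].

Definition is_right_nf (x : G) (s : seq G) : Prop :=
  [/\ (size s)%:Z%R = glen x,
      x = (\prod_(y <- s) y) * zpow Delta (ginf x),
      forall y, y \in s -> simple y /\ y <> 1,
      last 1 s <> Delta &
      forall i, (i.+1 < size s)%N -> right_weighted s`_i s`_i.+1].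

Definition left_nf (x : G) : seq G := xget [::] (is_left_nf x).

Definition right_nf (x : G) : seq G := xget [::] (is_right_nf x).

(* [tau^k] is the conjugation by [Delta^k]. *)
Definition giota (x : G) : G :=
  head 1 (left_nf x) ^ zpow Delta (- ginf x)%R.

Definition gphi (x : G) : G := last 1 (left_nf x).

Record xG_properties (a b x : G) : Prop := XGProperties {
  xG_inf : ginf x = 0%R;
  xG_nf : left_nf x = right_nf x;
  xG_ends : giota x = a /\ gphi x = a;
  xG_only_atoms : forall i, (i < size (left_nf x))%N ->
    atoms (left_nf x)`_i -> i = 0%N \/ i = (size (left_nf x)).-1;
  xG_factors : exists2 i, (i.+1 < size (left_nf x))%N &
    (left_nf x)`_i = b^-1 * Delta /\ (left_nf x)`_i.+1 = tau b^-1 * Delta;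
  xG_sup : (tau_order%:Z%R %| gsup x)%Z
}.

Definition absorbable (y : G) : Prop :=
  (ginf y = 0%R \/ gsup y = 0%R) /\
  exists x, ginf (x * y) = ginf x /\ gsup (x * y) = gsup x.

Definition Delta_coset (g : G) : set G :=
  [set h | exists k : int, h = g * zpow Delta k].

Record vertex := Vertex {
  vset : set G;
  vsetP : exists g, vset = Delta_coset g
}.

Definition vertex_of (g : G) : vertex :=
  Vertex (ex_intro (fun h => Delta_coset g = Delta_coset h) g erefl).

Definition vrep (v : vertex) : G := xget 1 [set x | vset v x /\ ginf x = 0%R].

Definition AL_edge (v w : vertex) : Prop :=
  (exists s, [/\ simple s, s <> 1, s <> Delta & vset w (vrep v * s)]) \/
  (exists y, absorbable y /\ vset w (vrep v * y)).

Definition AL_path (v w : vertex) (k : nat) : Prop :=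
  exists p : nat -> vertex,
    [/\ p 0%N = v, p k = w & forall i, (i < k)%N -> AL_edge (p i) (p i.+1)].

Definition d_AL (v w : vertex) : nat := set_min 0%N (AL_path v w).

End Garside.

Arguments vertex_of {n M} g.
Arguments Delta {n} M.
Arguments atoms {n} M.
Arguments gen {n} M i.
Arguments positive {n} M.
Arguments tau_order {n} M.

(* Main.v *)
(* The Coxeter group [W] acts on itself through the sets of reflections shortening
   its elements; this gives the exchange condition, the geometric representation
   gives the exact order of [s_i s_j], and Matsumoto's theorem lifts [W] to positive
   braid words.  An induction on length, in which common upper bounds are found in
   the weak order of the finite group [W], shows that positive words modulo the
   braid relations are cancellative and have the expected lcms of generators; they
   embed in the Artin-Tits group, which is therefore a Garside group.

   Let [X] be the element [x_G].  The factor [b^-1 D] of [X] blocks the left normal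
   form: every simple prefix of an element [X w] of infimum 0 is a prefix of the
   atom [a].  Moreover [D b^-1] is never absorbed, because multiplying by an atom
   cannot raise both the infimum and the supremum.  Hence if two elements of infimum
   0 are adjacent and [X^(k+1)] is a prefix of one of them, then [X^k] is a prefix
   of the other, so the largest such exponent is 1-Lipschitz along paths.  For
   negative powers one translates the path by a power of [X]. *)
Require Import Defs.
From HB Require Import structures.
From mathcomp Require Import all_boot all_order all_algebra all_field all_classical.
From mathcomp Require Import zify ring lra.

Set Implicit Arguments.
Unset Strict Implicit.
Unset Printing Implicit Defensive.

Import Order.TTheory GRing.Theory Num.Theory.
Local Open Scope group_scope.


(** Absorbable elements have unbounded length, so an edge cannot be treated as a bounded move. What
    survives is the predicate [moves]: a positive element that is simple or absorbed by something.
    It passes to factors and to conjugates by [Delta], and an absorbed element never has the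
    complement of an atom as a factor; the contradictions on the axis come from producing such a
    factor. One copy of [X] is lost per edge because two copies play different roles in
    [p y = X X w]: the second one blocks the simple prefixes of what follows, and this forces the
    first one into [p]. When the multiplication raises the infimum, the copy of [X] next to the
    multiplier is what keeps the powers of [Delta] away from the others. The degree, which is 1 on
    every atom, replaces noetherianity throughout: it bounds the inductions, yields greatest common
    divisors, and shows that nothing lies strictly between the complement of an atom and [Delta]. *)

Section Alternating.
Variable n : nat.
Implicit Types i j : 'I_n.

Definition alt i j (k : nat) : seq 'I_n := mkseq (fun l => if odd l then j else i) k.

Lemma alternatingE i j k : alternating i j k = [seq (l, false) | l <- alt i j k].
Proof. by rewrite /alternating /alt /mkseq -map_comp; apply: eq_map => l /=; case: odd. Qed.

Lemma size_alt i j k : size (alt i j k) = k.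
Proof. exact: size_mkseq. Qed.

Lemma altS i j k : alt i j k.+1 = i :: alt j i k.
Proof.
rewrite /alt /mkseq /= -[1%N]/(1 + 0)%N iotaDl -map_comp; congr (_ :: _).
by apply: eq_map => l /=; case: (odd l).
Qed.

End Alternating.

(** * Classes of words in a presented group *)

Section Presented.
Variables (I : choiceType) (R : word I -> word I -> Prop).
Local Notation G := (presented R).

Lemma word_class_nil : word_class R [::] = 1.
Proof. by []. Qed.

Lemma word_class_cat u v : word_class R (u ++ v) = word_class R u * word_class R v.
Proof. by rewrite -pr_mulE. Qed.

Lemma word_class_neg i : word_class R [:: (i, true)] = (word_class R [:: (i, false)])^-1.
Proof.
apply/eqP; rewrite -mulg_eq1 -word_class_cat; apply/eqP/word_classP.
exact: (word_eq_cancel R (i, true)).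
Qed.

Lemma word_class_pos (u : seq I) :
  word_class R [seq (i, false) | i <- u] = \prod_(i <- u) word_class R [:: (i, false)].
Proof.
elim: u => [|i u IH]; first by rewrite big_nil.
by rewrite big_cons -IH -word_class_cat.
Qed.

End Presented.

(** * The Coxeter group: reflection cocycle, length and exchange *)

Section CoxeterGroup.
Variables (n : nat) (M : coxeterMatrix n).
Local Notation W := (coxeter_group M).
Implicit Types (i j : 'I_n) (x y z t : W) (u v w : seq 'I_n).

Definition cgen i : W := word_class _ [:: (i, false)].

Definition cprod w : W := \prod_(i <- w) cgen i.

Lemma cprod_nil : cprod [::] = 1. Proof. exact: big_nil. Qed.

Lemma cprod_cons i w : cprod (i :: w) = cgen i * cprod w.
Proof. exact: big_cons. Qed.

Lemma cprod_cat u v : cprod (u ++ v) = cprod u * cprod v.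
Proof. exact: big_cat. Qed.

Lemma cgen_sq i : cgen i * cgen i = 1.
Proof.
rewrite -word_class_cat -word_class_nil; apply/word_classP/word_eq_rel.
by right; exists i.
Qed.

Lemma cgenV i : (cgen i)^-1 = cgen i.
Proof. by apply: mulg1_eq; apply: cgen_sq. Qed.

Lemma cgenK i x : cgen i * (cgen i * x) = x.
Proof. by rewrite mulgA cgen_sq mul1g. Qed.

Lemma cprod_rev w : cprod (rev w) = (cprod w)^-1.
Proof.
elim: w => [|i w IH]; first by rewrite cprod_nil invg1.
by rewrite rev_cons -cats1 cprod_cat cprod_cons cprod_nil mulg1 IH cprod_cons invgM cgenV.
Qed.

Lemma conj_gen_eq i t : (cgen i * t * cgen i == cgen i) = (t == cgen i).
Proof.
apply/eqP/eqP => [e|->]; last by rewrite cgen_sq mul1g.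
by apply: (mulgI (cgen i)); apply: (mulIg (cgen i)); rewrite e cgen_sq mul1g.
Qed.

Lemma word_class_cprod (w : word 'I_n) : word_class _ w = cprod (map fst w) :> W.
Proof.
elim: w => [|[i e] w IH]; first by rewrite cprod_nil.
rewrite -cat1s word_class_cat IH cprod_cons; congr (_ * _).
by case: e => //; rewrite word_class_neg cgenV.
Qed.

Lemma cprod_surj x : exists w, x = cprod w.
Proof. by exists (map fst (repr x)); rewrite -word_class_cprod word_classK. Qed.

Lemma cprod_alt i j k : M i j = Some k -> cprod (alt i j k) = cprod (alt j i k).
Proof.
case: (eqVneq i j) => [->//|ij] Mij.
rewrite /cprod -!word_class_pos -!alternatingE; apply/word_classP/word_eq_rel.
by left; exists i, j, k; split.
Qed.

Lemma cprod_alt2 i j k : cprod (alt i j k.*2) = (cgen i * cgen j) ^+ k.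
Proof.
elim: k => [|k IH]; first by rewrite cprod_nil.
by rewrite doubleS !altS !cprod_cons IH expgS mulgA.
Qed.

Lemma cprod_altS2 i j k : cprod (alt i j k.*2.+1) = (cgen i * cgen j) ^+ k * cgen i.
Proof.
elim: k => [|k IH]; first by rewrite cprod_cons cprod_nil mulg1 mul1g.
by rewrite doubleS !(altS, cprod_cons) -[alt j i _]/(alt j i _) -cprod_cons -altS IH expgS !mulgA.
Qed.

Lemma cgenM_expV i j k : (cgen j * cgen i) ^+ k = ((cgen i * cgen j) ^+ k)^-1.
Proof. by rewrite -expVgn invgM !cgenV. Qed.

Lemma cgenM_order i j k : i != j -> M i j = Some k -> (cgen i * cgen j) ^+ k = 1.
Proof.
move=> ij Mij; have := cprod_alt Mij.
have alt_even l : cprod (alt j i l.*2) = ((cgen i * cgen j) ^+ l)^-1.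
  by rewrite cprod_alt2 cgenM_expV.
rewrite -[k]odd_double_half; case: (odd k) => /=.
  rewrite add1n !cprod_altS2 => /(congr1 (fun x => x * cgen j)).
  rewrite -!mulgA cgen_sq mulg1 (cgenM_expV i j) => e.
  have -> : (k./2.*2.+1 = k./2 + k./2.+1)%N by lia.
  by rewrite expgnDr expgSr e mulgV.
rewrite add0n alt_even cprod_alt2 => e.
by rewrite -addnn expgnDr {1}e mulVg.
Qed.

(* [word_refl u t] is the parity of the number of prefixes [p i] of [u] with
   [t = p i p^-1].  It only depends on the class of [u] because the reflections
   met along the two sides of a braid relation are the same ones, in reverse
   order; this makes no use of the exact order of [s_i s_j]. *)
Fixpoint word_refl (u : word 'I_n) t : bool :=
  if u is l :: u' then (t == cgen l.1) (+) word_refl u' (cgen l.1 * t * cgen l.1)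
  else false.

Lemma word_refl_cat (u v : word 'I_n) t :
  word_refl (u ++ v) t = word_refl u t (+) word_refl v ((word_class _ u)^-1 * t * word_class _ u).
Proof.
elim: u t => [|[i e] u IH] t /=; first by rewrite word_class_nil invg1 mul1g mulg1.
rewrite IH -(cat1s (i, e) u) word_class_cat (word_class_cprod [:: (i, e)]) /= cprod_cons cprod_nil mulg1.
by rewrite invgM cgenV !mulgA addbA.
Qed.

Lemma word_refl_alternating i j k t :
  word_refl (alternating i j k) t
  = \big[addb/false]_(l < k) (t == (cgen i * cgen j) ^+ l * cgen i).
Proof.
elim: k i j t => [|k IH] i j t; first by rewrite big_ord0.
rewrite alternatingE altS /= -alternatingE IH big_ord_recl mul1g; congr addb.
apply: eq_bigr => l _ /=; rewrite /bump leq0n add1n.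
have -> : (cgen i * cgen j) ^+ l.+1 * cgen i = cgen i * ((cgen j * cgen i) ^+ l * cgen j) * cgen i.
  elim: (nat_of_ord l) => [|q IHq]; first by rewrite mul1g.
  by rewrite expgS -mulgA IHq expgS !mulgA.
apply/eqP/eqP => [<-|->]; first by rewrite -!mulgA cgen_sq mulg1 cgenK.
by rewrite -!mulgA cgen_sq mulg1 cgenK.
Qed.

Lemma word_refl_braid i j k t : i != j -> M i j = Some k ->
  word_refl (alternating i j k) t = word_refl (alternating j i k) t.
Proof.
move=> ij Mij; rewrite !word_refl_alternating (reindex_inj rev_ord_inj) /=.
apply: eq_bigr => l _; congr (_ == _).
have e := cgenM_order ij Mij.
rewrite (cgenM_expV i j); apply: (mulgI ((cgen i * cgen j) ^+ l)); rewrite mulVKg mulgA.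
rewrite -expgnDr; have -> : (l + (k - l.+1) = k.-1)%N by have := ltn_ord l; lia.
apply: (mulIg (cgen j)); rewrite -mulgA -expgSr cgen_sq prednK ?e //.
by apply: leq_ltn_trans (ltn_ord l).
Qed.

Lemma word_refl_wd (u v : word 'I_n) :
  word_eq (fun r q => braid_rel M r q \/ square_rel r q) u v ->
  word_refl u =1 word_refl v.
Proof.
elim=> [//|u0 v0 _ IH|v0 u0 w0 _ IH1 _ IH2|u0 u1 v0 v1 uu IHu vv IHv|l|u0 v0 Ruv] t.
- by rewrite IH.
- by rewrite IH1.
- have e : word_class _ u0 = word_class _ u1 :> W by exact/word_classP.
  by rewrite !word_refl_cat IHu IHv e.
- by case: l => i e; rewrite /= addbF conj_gen_eq addbb.
case: Ruv => [[i [j [k [ij Mij -> ->]]]]|[i [-> ->]]]; first exact: word_refl_braid.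
by rewrite /= addbF conj_gen_eq addbb.
Qed.

Definition refl x t : bool := word_refl (repr x) t.

Lemma refl_word_class (u : word 'I_n) t : refl (word_class _ u) t = word_refl u t.
Proof. by apply: word_refl_wd; apply: repr_word_class. Qed.

(** The cocycle rule for left inversion sets: those of [x], together with those of [y] transported
    by [x], the common ones cancelling. *)
Lemma reflM x y t : refl (x * y) t = refl x t (+) refl y (x^-1 * t * x).
Proof.
rewrite -[x]word_classK -[y]word_classK -word_class_cat !refl_word_class.
exact: word_refl_cat.
Qed.

Lemma refl_gen i t : refl (cgen i) t = (t == cgen i).
Proof. by rewrite refl_word_class /= addbF. Qed.

Lemma refl_genM i x t : refl (cgen i * x) t = (t == cgen i) (+) refl x (cgen i * t * cgen i).
Proof. by rewrite reflM refl_gen cgenV. Qed.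

Lemma refl1 t : refl 1 t = false.
Proof. by rewrite -word_class_nil refl_word_class. Qed.

Fact clen_subproof x : exists k, `[< exists w, x = cprod w /\ size w = k >].
Proof. by have [w ->] := cprod_surj x; exists (size w); apply/asboolP; exists w. Qed.

Definition clen x := ex_minn (clen_subproof x).

Lemma clen_le w : (clen (cprod w) <= size w)%N.
Proof. by rewrite /clen; case: ex_minnP => k _; apply; apply/asboolP; exists w. Qed.

Lemma clen_word x : exists2 w, x = cprod w & size w = clen x.
Proof. by rewrite /clen; case: ex_minnP => k /asboolP[w [-> <-]] _; exists w. Qed.

Definition reduced_word x : seq 'I_n := projT1 (cid2 (clen_word x)).

Lemma cprod_reduced_word x : cprod (reduced_word x) = x.
Proof. by rewrite /reduced_word; case: cid2. Qed.

Lemma size_reduced_word x : size (reduced_word x) = clen x.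
Proof. by rewrite /reduced_word; case: cid2. Qed.

Lemma clen1 : clen 1 = 0%N.
Proof. by apply/eqP; rewrite -leqn0 -cprod_nil; apply: clen_le. Qed.

Lemma clen_eq0 x : clen x = 0%N -> x = 1.
Proof. by have [w -> <-] := clen_word x => /size0nil ->; rewrite cprod_nil. Qed.

Lemma clenM x y : (clen (x * y) <= clen x + clen y)%N.
Proof.
have [u xu <-] := clen_word x; have [v yv <-] := clen_word y.
by rewrite xu yv -cprod_cat -size_cat; apply: clen_le.
Qed.

Lemma clenV_le x : (clen x^-1 <= clen x)%N.
Proof.
by have [u xu <-] := clen_word x; rewrite xu -cprod_rev -(size_rev u); apply: clen_le.
Qed.

Lemma clenV x : clen x^-1 = clen x.
Proof. by apply/eqP; rewrite eqn_leq clenV_le -{1}(invgK x) clenV_le. Qed.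

Lemma clen_gen_le i : (clen (cgen i) <= 1)%N.
Proof. by have := clen_le [:: i]; rewrite cprod_cons cprod_nil mulg1. Qed.

(** An odd count is nonzero, so some prefix [p i] of [w] has [t = p i p^-1]; deleting that letter
    [i] multiplies the product by [t] on the left. *)
Lemma refl_exchange_word w t : refl (cprod w) t ->
  exists2 w', cprod w' = t * cprod w & size w = (size w').+1.
Proof.
elim: w t => [|i w IH] t; first by rewrite cprod_nil refl1.
rewrite cprod_cons refl_genM; case: eqVneq => [-> _|_ /IH[w' e sw]].
  by exists w => //; rewrite cgenK.
by exists (i :: w') => /=; rewrite ?sw // cprod_cons e !mulgA cgen_sq mul1g -mulgA.
Qed.

Lemma refl_clen x t : refl x t -> (clen (t * x) < clen x)%N.
Proof.
have [w -> <-] := clen_word x => /refl_exchange_word[w' <- ->].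
by rewrite ltnS clen_le.
Qed.

Lemma refl_genF i x : ~~ refl x (cgen i) -> refl (cgen i * x) (cgen i).
Proof. by rewrite refl_genM eqxx cgen_sq mul1g; case: refl. Qed.

Lemma clen_desc i x : refl x (cgen i) -> clen x = (clen (cgen i * x)).+1.
Proof.
move=> /refl_clen h; have := clenM (cgen i) (cgen i * x); have := clen_gen_le i.
by rewrite cgenK; lia.
Qed.

Lemma clen_asc i x : ~~ refl x (cgen i) -> clen (cgen i * x) = (clen x).+1.
Proof. by move=> /refl_genF /clen_desc ->; rewrite cgenK. Qed.

Lemma clen_gen i : clen (cgen i) = 1%N.
Proof. by rewrite -[cgen i]mulg1 clen_asc ?clen1 // refl1. Qed.

Lemma refl_gen_clen i x : refl x (cgen i) = (clen (cgen i * x) < clen x)%N.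
Proof.
apply/idP/idP => [/refl_clen//|]; apply: contraLR => /clen_asc ->; lia.
Qed.

(** The weak order: a reduced word of [x] extends to the right to one of [y]. *)
Definition wle x y := clen y = (clen x + clen (x^-1 * y))%N.

Lemma wle_refl x : wle x x.
Proof. by rewrite /wle mulVg clen1 addn0. Qed.

Lemma wle1 x : wle 1 x.
Proof. by rewrite /wle invg1 mul1g clen1. Qed.

Lemma wle_trans y x z : wle x y -> wle y z -> wle x z.
Proof.
rewrite /wle => xy yz.
have h1 : (clen z <= clen x + clen (x^-1 * z))%N by rewrite -{1}(mulVKg x z) clenM.
have h2 : (clen (x^-1 * z) <= clen (x^-1 * y) + clen (y^-1 * z))%N.
  by rewrite -{1}(mulVKg y z) mulgA clenM.
lia.
Qed.

Lemma wle_gen i x : wle (cgen i) x <-> refl x (cgen i).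
Proof.
rewrite /wle cgenV clen_gen; split=> [e|/clen_desc ->]; last by rewrite add1n.
by rewrite refl_gen_clen e.
Qed.

Lemma wle_genM i x y : refl x (cgen i) -> refl y (cgen i) ->
  wle (cgen i * x) (cgen i * y) <-> wle x y.
Proof.
move=> /clen_desc xi /clen_desc yi.
have e : (cgen i * x)^-1 * (cgen i * y) = x^-1 * y by rewrite invgM cgenV -!mulgA cgenK.
rewrite /wle xi yi e.
by split; lia.
Qed.

Lemma refl_wle i x y : wle x y -> refl x (cgen i) -> refl y (cgen i).
Proof. by move=> xy /wle_gen xi; apply/wle_gen/(wle_trans xi). Qed.

(** Since [cgen i] is an inversion of [x * y] but not of [x], the cocycle puts its conjugate by [x]
    among the inversions of [y], so the deleted letter comes out of [y]. *)
Lemma clen_exchange i x y : clen (x * y) = (clen x + clen y)%N ->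
  refl (x * y) (cgen i) -> ~~ refl x (cgen i) ->
  exists y', [/\ x * y = cgen i * x * y', clen y = (clen y').+1 &
    clen (cgen i * x * y') = (clen (cgen i * x) + clen y')%N].
Proof.
move=> e; rewrite reflM => h1 h2; move: h1; rewrite (negbTE h2) addFb => /refl_clen.
set t := (_ * _ * x) => ht; exists (t * y).
have e1 : cgen i * x * (t * y) = x * y.
  by rewrite /t !mulgA -[_ * x * x^-1]mulgA mulgV mulg1 cgen_sq mul1g.
have := clenM (cgen i * x) (t * y); rewrite e1 (clen_asc h2) => h3.
by split=> //; lia.
Qed.

(** A reduced word of [x] is built from its last letter backwards: if a suffix lies below [z], the
    exchange with the next letter, which shortens [z] but not the suffix, keeps the longer suffix
    below [z]. *)
Lemma clen_top z : (forall i, refl z (cgen i)) -> forall x, wle x z.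
Proof.
move=> zi x; have [w -> +] := clen_word x.
elim: w => [|i w IH] sw; first by rewrite cprod_nil; apply: wle1.
have e : clen (cprod w) = size w.
  have := clenM (cgen i) (cprod w); have := clen_le w.
  by move: sw; rewrite cprod_cons clen_gen /=; lia.
have /IH wz := esym e; rewrite cprod_cons.
have iw : ~~ refl (cprod w) (cgen i).
  rewrite refl_gen_clen; move: sw; rewrite cprod_cons /= e; lia.
have := @clen_exchange i (cprod w) ((cprod w)^-1 * z).
rewrite mulVKg => /(_ wz (zi i) iw)[y' [e1 e2 e3]].
by rewrite /wle {2}e1 mulKg -e3 -e1.
Qed.

End CoxeterGroup.

(** * The exact order of a product of two generators *)

Section Reflections.
Local Open Scope ring_scope.
Variables (F : fieldType) (I : eqType) (a : I -> I -> F).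
Implicit Types (i j k : I) (f g : I -> F).

(* The contragredient of the reflection [e_j |-> e_j - a i j e_i]. *)
Definition reflect i f : I -> F := fun j => f j - a i j * f i.

Hypothesis a_diag : forall i, a i i = 2.

Lemma reflectK i : involutive (reflect i).
Proof. by move=> f; apply/funext => j; rewrite /reflect a_diag; ring. Qed.

Variables (i j : I) (z : F).
Hypotheses (z0 : z != 0) (aij : a i j = - (1 + z)) (aji : a j i = - (1 + z^-1)).

Local Notation T := (fun f => reflect i (reflect j f)).

(* The left eigenvectors of the rotation [T] on the plane of [e_i] and [e_j],
   for the eigenvalues [z] and [z^-1]. *)
Let U f := f i + f j.
Let V f := z * f i + f j.

Lemma rotate_eigen f l : U (iter l T f) = z ^+ l * U f /\ V (iter l T f) = z ^- l * V f.
Proof.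
elim: l => [|l [IHu IHv]]; first by rewrite !expr0 invr1 !mul1r.
rewrite /= exprS invfM -!mulrA -IHu -IHv /U /V /reflect !a_diag aij aji.
by split; field.
Qed.

(** Each reflection changes [f] by a multiple of a fixed row, so periodicity outside the plane of
    [i] and [j] reduces to the vanishing of two orbit sums. *)
Lemma rotate_sum f l k : iter l T f k
  = f k - a j k * (\sum_(q < l) iter q T f j)
    - a i k * (\sum_(q < l) iter q T f i - a j i * \sum_(q < l) iter q T f j).
Proof.
elim: l => [|l IH]; first by rewrite !big_ord0 /=; ring.
rewrite !big_ord_recr /= {1 2}/reflect /reflect IH; ring.
Qed.

(** The orbit sums of the two eigenvectors are geometric sums, hence zero. As the determinant of [U]
    and [V] in the coordinates [i], [j] is [1 - z], both coordinate sums vanish; this includes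
    [z = -1], where the eigenvalues coincide. *)
Lemma rotate_order m f : z != 1 -> z ^+ m = 1 -> iter m T f = f.
Proof.
move=> z1 zm.
have geom (y : F) : y != 1 -> y ^+ m = 1 -> \sum_(q < m) y ^+ q = 0.
  move=> y1 ym; apply/eqP; have /eqP := subrX1 y m; rewrite ym subrr eq_sym mulf_eq0.
  by rewrite subr_eq0 (negbTE y1).
set X := \sum_(q < m) iter q T f i; set Y := \sum_(q < m) iter q T f j.
have eU : X + Y = 0.
  rewrite -big_split /= (eq_bigr (fun q => z ^+ nat_of_ord q * U f)).
    by rewrite -mulr_suml geom // mul0r.
  by move=> q _; have [<-] := rotate_eigen f q.
have eV : z * X + Y = 0.
  rewrite mulr_sumr -big_split /= (eq_bigr (fun q => z^-1 ^+ nat_of_ord q * V f)).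
    by rewrite -mulr_suml geom ?mul0r // ?exprVn ?zm ?invr1 // invr_eq1.
  by move=> q _; rewrite exprVn; have [_ <-] := rotate_eigen f q.
have X0 : X = 0.
  have /eqP : (z - 1) * X = 0 by rewrite -[RHS](subrr 0) -{1}eV -eU; ring.
  by rewrite mulf_eq0 subr_eq0 (negbTE z1) => /eqP.
have Y0 : Y = 0 by rewrite -[RHS]eU X0 add0r.
by apply/funext => k; rewrite rotate_sum -/X -/Y X0 Y0; ring.
Qed.

Lemma rotate_faithful l : i != j -> (forall f, iter l T f = f) -> z ^+ l = 1.
Proof.
move=> ij /(_ (fun k => (k == i)%:R)) e.
have [] := rotate_eigen (fun k => (k == i)%:R) l; rewrite e /U eqxx eq_sym (negbTE ij) addr0 mulr1.
by move=> <-.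
Qed.

End Reflections.

Section Geometric.
Local Open Scope ring_scope.
Variables (n : nat) (M : coxeterMatrix n).
Local Notation W := (coxeter_group M).
Implicit Types (i j : 'I_n).

(** The filler at 0 is nonzero so that [geom_root_neq0] holds without a side condition. *)
Definition prim_root (k : nat) : algC :=
  if k is k'.+1 then sval (C_prim_root_exists (ltn0Sn k')) else 2.

(** The Cartan matrix is not symmetric: the entries [-(1+z)] and [-(1+z^-1)] have product
    [2+z+z^-1], which is [4 cos^2(pi/m)] up to Galois conjugation, so no square roots occur. The
    test [i < j] chooses which of the two entries carries [z]. For an infinite entry, 2 serves
    because it is not a root of unity. *)
Definition geom_root i j : algC :=
  let z := if M i j is Some k then prim_root k else 2 in
  if (i < j)%N then z else z^-1.

Definition geom_form i j : algC := if i == j then 2 else - (1 + geom_root i j).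

Lemma prim_rootP k : (0 < k)%N -> k.-primitive_root (prim_root k).
Proof. by case: k => // k _; rewrite /prim_root; case: C_prim_root_exists. Qed.

Lemma geom_rootV i j : i != j -> geom_root j i = (geom_root i j)^-1.
Proof.
move=> ij; rewrite /geom_root (coxeter_sym M j i).
have := neq_ltn i j; rewrite -[i == j :> nat]/(i == j) ij => /esym/orP[] h.
  by rewrite h ltnNge (ltnW h).
by rewrite h ltnNge (ltnW h) /= invrK.
Qed.

Lemma geom_root_expr_eq1 i j l :
  (0 < l)%N -> geom_root i j ^+ l = 1 -> exists2 k, M i j = Some k & (k %| l)%N.
Proof.
move=> l0 e; have {e} : (if M i j is Some k then prim_root k else 2) ^+ l = 1.
  move: e; rewrite /geom_root; case: ifP => // _.
  by rewrite exprVn => /(canRL invrK); rewrite invr1.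
case Mij: (M i j) => [k|]; last first.
  move=> /eqP; rewrite -natrX -[1]/(1%:R) eqr_nat => /eqP e.
  by have := ltn_expl l (isT : (1 < 2)%N); lia.
move=> e; exists k => //.
have k0 : (0 < k)%N.
  case: (eqVneq i j) => [ij|ij]; last exact: leq_trans (coxeter_offdiag ij Mij).
  by move: Mij; rewrite ij coxeter_diag => -[<-].
by rewrite (prim_order_dvd (prim_rootP k0)) e.
Qed.

Lemma geom_root_neq0 i j : geom_root i j != 0.
Proof.
have z0 k : prim_root k != 0.
  case: k => [|k]; first by rewrite pnatr_eq0.
  apply/eqP => e; have := prim_expr_order (prim_rootP (ltn0Sn k)).
  by rewrite e expr0n => /eqP; rewrite eq_sym oner_eq0.
by rewrite /geom_root; case: (M i j) => [k|]; case: ifP => _;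
  rewrite ?invr_eq0 ?z0 ?pnatr_eq0.
Qed.

Lemma geom_root_order i j k : i != j -> M i j = Some k ->
  geom_root i j != 1 /\ geom_root i j ^+ k = 1.
Proof.
move=> ij Mij; have k2 := coxeter_offdiag ij Mij.
have rk := prim_rootP (leq_trans (isT : (0 < 2)%N) k2).
have z1 : prim_root k != 1.
  by apply/eqP => e; have := prim_order_dvd rk 1; rewrite e expr1 eqxx dvdn1; lia.
rewrite /geom_root Mij; case: ifP => _; first by rewrite prim_expr_order.
by rewrite invr_eq1 exprVn prim_expr_order // invr1.
Qed.

Lemma geom_form_diag i : geom_form i i = 2.
Proof. by rewrite /geom_form eqxx. Qed.

Local Notation ref i := (reflect geom_form i).

Definition word_act (w : word 'I_n) (f : 'I_n -> algC) := foldr (fun l => ref l.1) f w.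

Lemma word_act_cat u v f : word_act (u ++ v) f = word_act u (word_act v f).
Proof. exact: foldr_cat. Qed.

Lemma word_act_altS i j k f :
  word_act (alternating i j k.+1) f = ref i (word_act (alternating j i k) f).
Proof. by rewrite !alternatingE altS. Qed.

Lemma word_act_alt2 i j k f :
  word_act (alternating i j k.*2) f = iter k (fun f => ref i (ref j f)) f.
Proof. by elim: k => [//|k IH]; rewrite doubleS !word_act_altS IH. Qed.

Lemma word_act_altS2 i j k f :
  word_act (alternating i j k.*2.+1) f = iter k (fun f => ref i (ref j f)) (ref i f).
Proof.
by elim: k => [|k IH]; [rewrite word_act_altS | rewrite doubleS 2!word_act_altS IH].
Qed.

Lemma word_act_braid i j k f : i != j -> M i j = Some k ->
  word_act (alternating i j k) f = word_act (alternating j i k) f.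
Proof.
move=> ij Mij; have [z1 zk] := geom_root_order ij Mij.
have aij : geom_form i j = - (1 + geom_root i j) by rewrite /geom_form (negbTE ij).
have aji : geom_form j i = - (1 + (geom_root i j)^-1).
  by rewrite /geom_form eq_sym (negbTE ij) geom_rootV.
have T1 g := rotate_order geom_form_diag (geom_root_neq0 i j) aij aji g z1 zk.
set T := (fun f => reflect _ i _) in T1.
(* [T'] inverts [T], so applying [iter h T] to both sides turns the braid relation into
   [T^k = 1]. *)
set T' := (fun f => ref j (ref i f)).
have TV l : cancel (iter l T') (iter l T).
  elim: l => [//|l IH] g.
  by rewrite iterSr (iterS _ T') /T /T' !(reflectK geom_form_diag) IH.
have TI l : injective (iter l T).
  by elim: l => [//|l IH] g h; rewrite !iterS => /(can_inj (reflectK geom_form_diag i));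
    move=> /(can_inj (reflectK geom_form_diag j)) /IH.
have [h [e|e]] : exists h, k = h.*2.+1 \/ k = h.*2 by exists k./2; lia.
  move: T1; rewrite e => T1.
  rewrite !word_act_altS2; apply: (TI h); rewrite TV.
  by rewrite -iterD addnn -[RHS]T1 iterSr /T (reflectK geom_form_diag).
move: T1; rewrite e => T1; rewrite !word_act_alt2; apply: (TI h); rewrite TV.
by rewrite -iterD addnn -[RHS]T1.
Qed.

Lemma word_act_wd (u v : word 'I_n) :
  word_eq (fun r q => braid_rel M r q \/ square_rel r q) u v -> word_act u = word_act v.
Proof.
have refK i : involutive (ref i) by apply/reflectK/geom_form_diag.
elim=> [//|u0 v0 _ IH|v0 u0 w0 _ IH1 _ IH2|u0 u1 v0 v1 _ IHu _ IHv|l|u0 v0 Ruv].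
- by rewrite IH.
- by rewrite IH1.
- by apply/funext => f; rewrite !word_act_cat IHu IHv.
- by apply/funext => f /=; rewrite refK.
apply/funext => f; case: Ruv => [[i [j [k [ij Mij -> ->]]]]|[i [-> ->]]].
  exact: word_act_braid.
by rewrite /= refK.
Qed.

Lemma cgenM_order_dvd i j l : i != j -> (0 < l)%N ->
  ((cgen M i * cgen M j) ^+ l = 1)%g -> exists2 k, M i j = Some k & (k %| l)%N.
Proof.
move=> ij l0; rewrite -cprod_alt2 /cprod -word_class_pos -alternatingE -word_class_nil.
move=> /word_classP /word_act_wd e.
apply: geom_root_expr_eq1 => //.
have aij : geom_form i j = - (1 + geom_root i j) by rewrite /geom_form (negbTE ij).
have aji : geom_form j i = - (1 + (geom_root i j)^-1).
  by rewrite /geom_form eq_sym (negbTE ij) geom_rootV.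
apply: (rotate_faithful geom_form_diag (geom_root_neq0 i j) aij aji ij) => f.
by rewrite -word_act_alt2 e.
Qed.

End Geometric.

(** * Matsumoto's theorem *)

Section Matsumoto.
Variables (n : nat) (M : coxeterMatrix n).
Local Notation W := (coxeter_group M).
Local Notation cgen := (cgen M).
Local Notation cprod := (cprod M).
Implicit Types (i j : 'I_n) (x y z t : W) (u v w : seq 'I_n).

(** The exact order of [s_i s_j] enters here: meeting [s_j] along the word would give
    [(s_i s_j)^(l+1) = 1] with [l+1] smaller than [m_ij]. *)
Lemma refl_cprod_alt i j q : i != j -> (forall k, M i j = Some k -> (q < k)%N) ->
  ~~ refl (cprod (alt i j q)) (cgen j).
Proof.
move=> ij qk; rewrite /cprod -word_class_pos -alternatingE refl_word_class word_refl_alternating.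
rewrite big1 // => -[l /= lq] _; apply/eqP => e.
have {e} : (cgen i * cgen j) ^+ l.+1 = 1 by rewrite expgSr mulgA -e cgen_sq.
by move=> /(cgenM_order_dvd ij (ltn0Sn l))[k /qk h] /dvdn_leq; lia.
Qed.

Lemma alt_descent_step i j q x y : i != j -> (forall k, M i j = Some k -> (q < k)%N) ->
  refl x (cgen j) -> x = cprod (alt i j q) * y -> clen x = (q + clen y)%N ->
  exists2 y', x = cprod (alt j i q.+1) * y' & clen x = (q.+1 + clen y')%N.
Proof.
move=> ij qk xj xe lx; have h := refl_cprod_alt ij qk.
have lq : clen (cprod (alt i j q)) = q.
  have := clen_le M (alt i j q); have := clenM (cprod (alt i j q)) y.
  rewrite -xe size_alt lx; lia.
have := @clen_exchange _ _ j (cprod (alt i j q)) y.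
rewrite -xe lq lx => /(_ erefl xj h)[y' [e1 e2 e3]].
by exists y'; rewrite ?altS ?cprod_cons //; lia.
Qed.

(** As long as the alternating prefix of [x] is shorter than [m_ij], one of the two descents fails
    to shorten it, and exchange prepends that letter. For an infinite [m_ij] the prefix would
    outgrow [x]. *)
Lemma alt_descents i j x : i != j -> refl x (cgen i) -> refl x (cgen j) ->
  exists k y, [/\ M i j = Some k, x = cprod (alt i j k) * y & clen x = (k + clen y)%N].
Proof.
move=> ij xi xj.
pose red q := exists y, (x = cprod (alt i j q) * y \/ x = cprod (alt j i q) * y)
  /\ clen x = (q + clen y)%N.
have redS q : (0 < q)%N -> (forall k, M i j = Some k -> (q < k)%N) -> red q -> red q.+1.
  move=> q0 qk [y [[xe|xe] lx]].
    by have [y' ? ?] := alt_descent_step ij qk xj xe lx; exists y'; split=> //; right.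
  have ji : j != i by rewrite eq_sym.
  have qk' k : M j i = Some k -> (q < k)%N by rewrite coxeter_sym; apply: qk.
  by have [y' ? ?] := alt_descent_step ji qk' xi xe lx; exists y'; split=> //; left.
have red1 : red 1%N.
  exists (cgen i * x); split; last by rewrite (clen_desc xi).
  by left; rewrite cprod_cons cprod_nil mulg1 cgenK.
have redq q : (0 < q)%N -> (forall k, M i j = Some k -> (q <= k)%N) -> red q.
  elim: q => // q IH _ qk; case: (posnP q) => [->//|q0].
  by apply: redS => //; apply: IH => // k /qk; lia.
case Mij: (M i j) => [k|].
  have k2 := coxeter_offdiag ij Mij.
  have [|k' |y [e lx]] := redq k; first by lia.
    by rewrite Mij => -[->].
  exists k, y; split=> //; case: e => // ->; congr (_ * _).
  by apply: cprod_alt; rewrite coxeter_sym.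
have [//|k|y [_]] := redq (clen x).+1; first by rewrite Mij.
by lia.
Qed.

Definition braid_step u v := exists p q i j k,
  [/\ i != j, M i j = Some k, u = p ++ alt i j k ++ q & v = p ++ alt j i k ++ q].

(** The congruence is a chain of elementary moves, so that cancellation can be proved by adding one
    move at a time. *)
Inductive braid_eq u : seq 'I_n -> Prop :=
| braid_eq_refl : braid_eq u u
| braid_eq_step v w : braid_eq u v -> braid_step v w -> braid_eq u w.

Lemma braid_eq_trans v u w : braid_eq u v -> braid_eq v w -> braid_eq u w.
Proof. by move=> uv; elim=> // w' w'' _ IH st; apply: braid_eq_step st. Qed.

Lemma braid_step_sym u v : braid_step u v -> braid_step v u.
Proof.
move=> [p [q [i [j [k [ij Mij -> ->]]]]]]; exists p, q, j, i, k.
by split; rewrite 1?eq_sym // coxeter_sym.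
Qed.

Lemma braid_eq_sym u v : braid_eq u v -> braid_eq v u.
Proof.
elim=> [|v' w _ IH st]; first exact: braid_eq_refl.
by apply: braid_eq_trans IH; apply: braid_eq_step (braid_step_sym st); apply: braid_eq_refl.
Qed.

Lemma braid_eq_ctx p q u v : braid_eq u v -> braid_eq (p ++ u ++ q) (p ++ v ++ q).
Proof.
elim=> [|v' w _ IH [p' [q' [i [j [k [ij Mij e ->]]]]]]]; first exact: braid_eq_refl.
apply: braid_eq_step IH _; rewrite {}e.
by exists (p ++ p'), (q' ++ q), i, j, k; split=> //; rewrite -!catA.
Qed.

Lemma braid_eq_cat u u' v v' : braid_eq u u' -> braid_eq v v' -> braid_eq (u ++ v) (u' ++ v').
Proof.
move=> uu vv; apply: (@braid_eq_trans (u' ++ v)); first exact: (braid_eq_ctx [::] v uu).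
by have := braid_eq_ctx u' [::] vv; rewrite !cats0.
Qed.

Lemma braid_eq_catl p u v : braid_eq u v -> braid_eq (p ++ u) (p ++ v).
Proof. by move=> uv; apply: braid_eq_cat uv; apply: braid_eq_refl. Qed.

Lemma braid_eq_cons i u v : braid_eq u v -> braid_eq (i :: u) (i :: v).
Proof. exact: (@braid_eq_catl [:: i]). Qed.

Lemma braid_eq_catr p u v : braid_eq u v -> braid_eq (u ++ p) (v ++ p).
Proof. by move=> uv; apply: braid_eq_cat uv _; apply: braid_eq_refl. Qed.

Lemma braid_eq_alt i j k : M i j = Some k -> braid_eq (alt i j k) (alt j i k).
Proof.
case: (eqVneq i j) => [-> _|ij Mij]; first exact: braid_eq_refl.
apply: braid_eq_step (braid_eq_refl _) _.
by exists [::], [::], i, j, k; rewrite !cats0.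
Qed.

Lemma braid_eq_size u v : braid_eq u v -> size u = size v.
Proof.
elim=> // v' w _ -> [p [q [i [j [k [_ _ -> ->]]]]]].
by rewrite !size_cat !size_alt.
Qed.

Lemma braid_eq_cprod u v : braid_eq u v -> cprod u = cprod v.
Proof.
elim=> // v' w _ -> [p [q [i [j [k [_ Mij -> ->]]]]]].
by rewrite !cprod_cat (cprod_alt Mij).
Qed.

Definition reduced u := clen (cprod u) = size u.

Lemma reduced_reduced_word x : reduced (reduced_word x).
Proof. by rewrite /reduced cprod_reduced_word size_reduced_word. Qed.

Lemma reduced_catr u v : reduced (u ++ v) -> reduced v.
Proof.
rewrite /reduced cprod_cat size_cat => e.
by have := clenM (cprod u) (cprod v); have := clen_le M u; have := clen_le M v; lia.
Qed.

Lemma reduced_head i u : reduced (i :: u) -> refl (cprod (i :: u)) (cgen i).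
Proof.
move=> h; have h' := @reduced_catr [:: i] u h.
rewrite refl_gen_clen cprod_cons cgenK -cprod_cons.
by move: h h'; rewrite /reduced => -> ->.
Qed.

(** If the first letters [i], [j] differ, both are descents, so the element also has reduced words
    beginning with the two sides of the braid relation. Each side shares its first letter with [u]
    or [v], where induction applies. *)
Theorem matsumoto u v : reduced u -> reduced v -> cprod u = cprod v -> braid_eq u v.
Proof.
elim: {u}(size u) {-2}u (leqnn (size u)) v => [|m IH] [|i u] //= su v ru rv e.
- by move: rv; rewrite /reduced -e cprod_nil clen1 => /esym/size0nil ->; apply: braid_eq_refl.
- by move: rv; rewrite /reduced -e cprod_nil clen1 => /esym/size0nil ->; apply: braid_eq_refl.
case: v rv e => [|j v] rv e.
  by move: ru; rewrite /reduced e cprod_nil clen1.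
have ru' := @reduced_catr [:: i] u ru; have rv' := @reduced_catr [:: j] v rv.
have suv : size u = size v by move: ru rv; rewrite /reduced e => -> /= [].
case: (eqVneq i j) => [eij|ij].
  move: e; rewrite -eij !cprod_cons => /mulgI e.
  by apply: braid_eq_cons; apply: IH.
have xi := reduced_head ru; have xj := reduced_head rv; rewrite -e in xj.
have [k [y [Mij xe lx]]] := alt_descents ij xi xj.
have := coxeter_offdiag ij Mij; case: k Mij xe lx => // k Mij xe lx _.
have ru1 : reduced (alt i j k.+1 ++ reduced_word y).
  rewrite /reduced cprod_cat cprod_reduced_word -xe lx size_cat size_alt.
  by rewrite size_reduced_word.
have e1 : braid_eq (alt i j k.+1 ++ reduced_word y) (alt j i k.+1 ++ reduced_word y).
  by apply: braid_eq_catr; apply: braid_eq_alt.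
have e2 := braid_eq_cprod e1.
have ru2 : reduced (alt j i k.+1 ++ reduced_word y).
  by rewrite /reduced -e2 -(braid_eq_size e1).
have e0 : cprod (alt i j k.+1 ++ reduced_word y) = cprod (i :: u).
  by rewrite cprod_cat cprod_reduced_word.
apply: (@braid_eq_trans (alt i j k.+1 ++ reduced_word y)).
  move: ru1 e0; rewrite altS cat_cons => ru1; rewrite !cprod_cons => /mulgI e0.
  by apply: braid_eq_cons; apply: IH; rewrite ?e0 //; apply: (@reduced_catr [:: i]).
apply: (braid_eq_trans e1).
move: ru2 e2; rewrite e0 e altS cat_cons => ru2; rewrite !cprod_cons => /mulgI e2.
apply: braid_eq_cons; apply: braid_eq_sym; apply: IH; rewrite -?suv //.
exact: (@reduced_catr [:: j]).
Qed.

End Matsumoto.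

(** * Cancellation and least common multiples of positive words *)

Section BraidMonoid.
Variables (n : nat) (M : coxeterMatrix n).
Local Notation W := (coxeter_group M).
Local Notation cgen := (cgen M).
Local Notation cprod := (cprod M).
Local Notation braid_eq := (braid_eq M).
Local Notation reduced := (reduced M).
Implicit Types (i j c : 'I_n) (x y z : W) (u v w : seq 'I_n).
Variable w0 : W.
Hypothesis w0_top : forall x, wle x w0.

Lemma refl_genK i x : refl (cgen i * x) (cgen i) = ~~ refl x (cgen i).
Proof. by rewrite refl_genM eqxx cgen_sq mul1g. Qed.

Lemma refl_top i : refl w0 (cgen i).
Proof. by apply/wle_gen. Qed.

Lemma coxeter_finite i j : exists k, M i j = Some k.
Proof.
case: (eqVneq i j) => [->|ij]; first by exists 1%N; rewrite coxeter_diag.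
by have [k [y [-> _ _]]] := alt_descents ij (refl_top i) (refl_top j); exists k.
Qed.

Lemma reduced_alt i j k : i != j -> M i j = Some k -> reduced (alt i j k).
Proof.
move=> ij Mij; have [k' [y [+ e l]]] := alt_descents ij (refl_top i) (refl_top j).
rewrite Mij => -[?]; subst k'.
have := clenM (cprod (alt i j k)) y; have := clen_le M (alt i j k).
by rewrite /reduced -e size_alt l; lia.
Qed.

Lemma refl_alt i j k : i != j -> M i j = Some k ->
  refl (cprod (alt i j k)) (cgen i) /\ refl (cprod (alt i j k)) (cgen j).
Proof.
move=> ij Mij; have k2 := coxeter_offdiag ij Mij.
have h i' j' : i' != j' -> M i' j' = Some k -> refl (cprod (alt i' j' k)) (cgen i').
  move=> ij' Mij'; have := reduced_alt ij' Mij'; case: k k2 {Mij Mij'} => // k _.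
  by rewrite altS => /reduced_head.
by split; [|rewrite (cprod_alt Mij)]; apply: h => //; rewrite 1?eq_sym // coxeter_sym.
Qed.

Lemma reduced_cat_wle x y : wle x y -> reduced (reduced_word x ++ reduced_word (x^-1 * y)).
Proof.
by rewrite /reduced cprod_cat !cprod_reduced_word mulVKg size_cat !size_reduced_word => ->.
Qed.

Lemma reduced_word_cat x y : wle x y ->
  braid_eq (reduced_word y) (reduced_word x ++ reduced_word (x^-1 * y)).
Proof.
move=> xy; apply: matsumoto (reduced_reduced_word _) (reduced_cat_wle xy) _.
by rewrite cprod_cat !cprod_reduced_word mulVKg.
Qed.

Lemma reduced_word_cons i x : refl x (cgen i) ->
  braid_eq (reduced_word x) (i :: reduced_word (cgen i * x)).
Proof.
move=> xi; apply: matsumoto (reduced_reduced_word _) _ _.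
  by rewrite /reduced /= cprod_cons !cprod_reduced_word cgenK size_reduced_word (clen_desc xi).
by rewrite cprod_cons !cprod_reduced_word cgenK.
Qed.

Lemma reduced_word1 : reduced_word (1 : W) = [::].
Proof. by apply: size0nil; rewrite size_reduced_word clen1. Qed.

Lemma refl_exists x : x <> 1 -> exists i, refl x (cgen i).
Proof.
have [[|i w] -> lw] := clen_word x; first by rewrite cprod_nil.
by move=> _; exists i; apply: reduced_head; rewrite /reduced lw.
Qed.

(** Left divisibility in the braid monoid by the lift of [x], which is independent of the reduced
    word by Matsumoto. *)
Definition lift_dvd x u := exists v, braid_eq (reduced_word x ++ v) u.

Lemma lift_dvd_alt i j k u w : i != j -> M i j = Some k ->
  braid_eq u (alt i j k ++ w) -> lift_dvd (cprod (alt i j k)) u.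
Proof.
move=> ij Mij e; exists w; apply: braid_eq_trans (braid_eq_sym e).
apply: braid_eq_catr; apply: matsumoto (reduced_reduced_word _) (reduced_alt ij Mij) _.
by rewrite cprod_reduced_word.
Qed.

(** What an equality of [i :: u] and [j :: v] should imply: cancellation for equal heads, otherwise
    divisibility by the lcm of the heads. Removing the first letter of the lcm accounts for [k.-1]
    and the swapped indices. *)
Definition head_rel i u j v :=
  if i == j then braid_eq u v else
  exists k w, [/\ M i j = Some k, braid_eq u (alt j i k.-1 ++ w) & braid_eq v (alt i j k.-1 ++ w)].

Definition cancellative m := forall i j u v, (size u < m)%N ->
  braid_eq (i :: u) (j :: v) -> head_rel i u j v.

Lemma cancellative_catl m p u v : cancellative m -> (size (p ++ u) <= m)%N ->
  braid_eq (p ++ u) (p ++ v) -> braid_eq u v.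
Proof.
move=> cm; elim: p => //= i p IH s /(cm i i _ _ s).
by rewrite /head_rel eqxx; apply: IH; apply: ltnW.
Qed.

(* Only an upper bound inside the interval below [z] is needed, not a join. *)
Lemma lift_dvd_bound m u x y z : cancellative m -> (size u <= m)%N ->
  wle x z -> wle y z -> lift_dvd x u -> lift_dvd y u ->
  exists t, [/\ wle x t, wle y t, wle t z & lift_dvd t u].
Proof.
move=> cm; elim: {u}(size u) {-2}u (leqnn (size u)) x y z => [|l IH] u su x y z um xz yz xu yu.
  have unil : u = [::] by apply: size0nil; lia.
  have lift1 t : lift_dvd t u -> t = 1.
    move=> [v /braid_eq_size]; rewrite unil size_cat size_reduced_word /= => e.
    by apply: clen_eq0; lia.
  exists y; rewrite {1}(lift1 _ xu); split=> //; [exact: wle1 | exact: wle_refl].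
have same i x' y' : wle x' z -> wle y' z -> lift_dvd x' u -> lift_dvd y' u ->
    refl x' (cgen i) -> refl y' (cgen i) ->
    exists t, [/\ wle x' t, wle y' t, wle t z & lift_dvd t u].
  move=> xz' yz' [vx xu'] [vy yu'] xi yi.
  have zi := refl_wle xz' xi.
  have hx := braid_eq_trans (braid_eq_sym (braid_eq_catr vx (reduced_word_cons xi))) xu'.
  have hy := braid_eq_trans (braid_eq_sym (braid_eq_catr vy (reduced_word_cons yi))) yu'.
  move: hx hy => /=; set ux := _ ++ vx; set uy := _ ++ vy => hx hy.
  have sx : (size ux).+1 = size u := braid_eq_size hx.
  have := cm i i ux uy; rewrite /head_rel eqxx => hxy.
  have {}hxy : braid_eq ux uy.
    by apply: hxy; [lia | apply: braid_eq_trans hx (braid_eq_sym hy)].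
  have [||||||t [h1 h2 h3 [v hv]]] := IH ux _ (cgen i * x') (cgen i * y') (cgen i * z).
  - by lia.
  - by lia.
  - exact/wle_genM.
  - exact/wle_genM.
  - by exists vx; apply: braid_eq_refl.
  - by exists vy; apply: braid_eq_sym.
  (* The ceiling is used here: [t] lies below [cgen i * z], which does not have [i] as a descent, so
     neither does [t]. *)
  have ti : refl (cgen i * t) (cgen i).
    by rewrite refl_genK; apply/negP => /(refl_wle h3); rewrite refl_genK zi.
  exists (cgen i * t); split.
  - by apply/(wle_genM xi ti); rewrite cgenK.
  - by apply/(wle_genM yi ti); rewrite cgenK.
  - by apply/(wle_genM ti zi); rewrite cgenK.
  exists v; apply: braid_eq_trans (braid_eq_catr v (reduced_word_cons ti)) _.
  by rewrite cgenK /=; apply: braid_eq_trans hx; apply: braid_eq_cons.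
have [->|/refl_exists[i xi]] := EM (x = 1); first by exists y; split=> //; [apply: wle1|apply: wle_refl].
have [->|/refl_exists[j yj]] := EM (y = 1); first by exists x; split=> //; [apply: wle_refl|apply: wle1].
case: (eqVneq i j) => [eij|ij]; first by apply: (same i) => //; rewrite eij.
have zi := refl_wle xz xi; have zj := refl_wle yz yj.
have [k [y1 [Mij ez lz]]] := alt_descents ij zi zj.
have [vx xu'] := xu; have [vy yu'] := yu.
have hx := braid_eq_trans (braid_eq_sym (braid_eq_catr vx (reduced_word_cons xi))) xu'.
have hy := braid_eq_trans (braid_eq_sym (braid_eq_catr vy (reduced_word_cons yj))) yu'.
move: hx hy => /=; set ux := _ ++ vx; set uy := _ ++ vy => hx hy.
have sx : (size ux).+1 = size u := braid_eq_size hx.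
have := cm i j ux uy; rewrite /head_rel (negbTE ij) => hxy.
have [||k' [w [+ hw _]]] := hxy.
- by lia.
- exact: braid_eq_trans hx (braid_eq_sym hy).
rewrite Mij => -[?]; subst k'.
have k2 := coxeter_offdiag ij Mij.
(* The lcm of [i] and [j] is a bridge: it has a descent in common with [x] and one with [y], and the
   two resulting bounds share the descent [i]. *)
have uij : lift_dvd (cprod (alt i j k)) u.
  apply: (lift_dvd_alt (w := w)) => //; apply: braid_eq_trans (braid_eq_sym hx) _.
  by rewrite -[k]prednK ?altS; [apply: braid_eq_cons | lia].
have zij : wle (cprod (alt i j k)) z.
  by rewrite /wle (reduced_alt ij Mij) size_alt {2}ez mulKg.
have [wi wj] := refl_alt ij Mij.
have [t1 [xt1 wt1 zt1 ut1]] := same i _ _ xz zij xu uij xi wi.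
have [t2 [yt2 wt2 zt2 ut2]] := same j _ _ yz zij yu uij yj wj.
have [t [h1 h2 h3 h4]] := same i _ _ zt1 zt2 ut1 ut2 (refl_wle wt1 wi) (refl_wle wt2 wi).
by exists t; split=> //; [apply: wle_trans h1 | apply: wle_trans h2].
Qed.


Lemma head_rel_step i u j v : braid_step M (i :: u) (j :: v) -> head_rel i u j v.
Proof.
move=> [[|l p] [q [i' [j' [k [ij Mij]]]]]].
  have := coxeter_offdiag ij Mij; case: k Mij => // k Mij _.
  rewrite !altS !cat_cons => -[-> ->] [-> ->]; rewrite /head_rel (negbTE ij).
  by exists k.+1, q; split=> //; apply: braid_eq_refl.
rewrite !cat_cons => -[-> ->] [-> ->]; rewrite /head_rel eqxx.
by apply: braid_eq_catl; apply: braid_eq_catr; apply: braid_eq_alt.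
Qed.

(* If [t] is a bound of [c w_ic] and [c w_jc] with [c t > t], then [c t] is
   reachable both from [i :: u] and from [j :: v], and it has [i] and [j] as
   descents. *)
Lemma head_rel_lift m i c u v k w t r v1 : cancellative m -> (size v <= m)%N ->
  i != c -> M i c = Some k ->
  braid_eq u (alt c i k.-1 ++ w) -> braid_eq v (alt i c k.-1 ++ w) ->
  wle (cprod (alt i c k.-1)) t -> ~~ refl t (cgen c) -> braid_eq (reduced_word t ++ v1) v ->
  reduced (i :: r) -> cprod (i :: r) = cgen c * t -> braid_eq u (r ++ v1).
Proof.
move=> cm sv ic Mic hu hv xt tc tv rr er.
have k2 := coxeter_offdiag ic Mic; have k0 : k = k.-1.+1 by lia.
set x := cprod (alt i c k.-1) in xt.
have Mci : M c i = Some k by rewrite coxeter_sym.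
have ci : c != i by rewrite eq_sym.
have rx : reduced (alt i c k.-1).
  by have := reduced_alt ci Mci; rewrite k0 altS => /(@reduced_catr _ _ [:: c]).
have hw : braid_eq w (reduced_word (x^-1 * t) ++ v1).
  apply: (cancellative_catl (p := alt i c k.-1) cm).
    by rewrite -(braid_eq_size hv).
  apply: braid_eq_trans (braid_eq_sym hv) _; apply: braid_eq_trans (braid_eq_sym tv) _.
  rewrite catA; apply: braid_eq_catr; apply: braid_eq_trans (reduced_word_cat xt) _.
  apply: braid_eq_catr; apply: matsumoto rx _; first exact: reduced_reduced_word.
  by rewrite cprod_reduced_word.
apply: braid_eq_trans hu _; apply: braid_eq_trans (braid_eq_catl _ hw) _.
rewrite catA; apply: braid_eq_catr.
have e : cprod (i :: alt c i k.-1 ++ reduced_word (x^-1 * t)) = cgen c * t.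
  rewrite -cat_cons -altS -k0 cprod_cat cprod_reduced_word (cprod_alt Mic) k0 altS cprod_cons.
  by rewrite -/x -mulgA mulVKg.
apply: matsumoto.
- apply: (@reduced_catr _ _ [:: i]); rewrite /reduced [_ ++ _]/= e clen_asc //.
  move: xt; rewrite /wle => ->; rewrite [size _]/= size_cat size_alt size_reduced_word.
  by rewrite /x rx size_alt.
- exact: (@reduced_catr _ _ [:: i]).
by apply: (mulgI (cgen i)); rewrite -!cprod_cons e.
Qed.

(** Chains of moves compose through this transitivity. The essential case has three distinct heads
    and is a cube condition on three generators. *)
Lemma head_rel_trans m i u c w j v : cancellative m -> (size w <= m)%N ->
  head_rel i u c w -> head_rel c w j v -> head_rel i u j v.
Proof.
move=> cm sw; rewrite /head_rel.
case: (eqVneq i c) => [->|ic].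
  move=> uw; case: (eqVneq c j) => [_|cj]; first exact: braid_eq_trans uw.
  by move=> [k [q [Mij hw hv]]]; exists k, q; split=> //; apply: braid_eq_trans hw.
move=> [k1 [w1 [Mic hu hw1]]]; case: (eqVneq c j) => [<- wv|cj].
  rewrite (negbTE ic); exists k1, w1; split=> //.
  by apply: braid_eq_trans (braid_eq_sym wv) hw1.
move=> [k2 [w2 [Mcj hw2 hv]]]; case: (eqVneq i j) => [eij|ij].
  move: cj Mcj hw2 hv; rewrite -eij => _; rewrite coxeter_sym Mic => -[<-] hw2 hv.
  have h : braid_eq w1 w2.
    apply: (cancellative_catl (p := alt i c k1.-1) cm); first by rewrite -(braid_eq_size hw1).
    exact: braid_eq_trans (braid_eq_sym hw1) hw2.
  apply: braid_eq_trans hu _; apply: braid_eq_sym; apply: braid_eq_trans hv _.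
  by apply: braid_eq_catl; apply: braid_eq_sym.
have jc : j != c by rewrite eq_sym.
have Mjc : M j c = Some k2 by rewrite coxeter_sym.
(* The ceiling [cgen c * w0] is chosen because nothing below it has [c] as a descent; the common
   bound [t] can then be preceded by [c]. *)
have bnd l k q : l != c -> M l c = Some k -> braid_eq w (alt l c k.-1 ++ q) ->
    [/\ wle (cprod (alt l c k.-1)) (cgen c * w0), lift_dvd (cprod (alt l c k.-1)) w,
        cgen c * cprod (alt l c k.-1) = cprod (alt l c k) &
        ~~ refl (cprod (alt l c k.-1)) (cgen c)].
  move=> lc Mlc hq; have ck2 := coxeter_offdiag lc Mlc; have k0 : k = k.-1.+1 by lia.
  have Mcl : M c l = Some k by rewrite coxeter_sym.
  have e : cgen c * cprod (alt l c k.-1) = cprod (alt l c k).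
    by rewrite -(cprod_alt Mcl) [in RHS]k0 altS cprod_cons.
  have [_ xc] := refl_alt lc Mlc.
  have xc' : ~~ refl (cprod (alt l c k.-1)) (cgen c) by rewrite -refl_genK e.
  split=> //; first by rewrite -(cgenK c (cprod _)) e; apply/wle_genM => //; apply: refl_top.
  exists q; apply: braid_eq_trans (braid_eq_sym hq).
  apply: braid_eq_catr; apply: matsumoto (reduced_reduced_word _) _ _.
    have cl : c != l by rewrite eq_sym.
    by have := reduced_alt cl Mcl; rewrite k0 altS => /(@reduced_catr _ _ [:: c]).
  by rewrite cprod_reduced_word.
have [xz xw ex xc] := bnd i k1 w1 ic Mic hw1.
have [yz yw ey yc] := bnd j k2 w2 jc Mjc hw2.
have [t [xt yt tz [v1 tv]]] := lift_dvd_bound cm sw xz yz xw yw.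
have tc : ~~ refl t (cgen c).
  by apply/negP => /(refl_wle tz); rewrite refl_genK refl_top.
have Tc : refl (cgen c * t) (cgen c) by rewrite refl_genK.
have Ti : refl (cgen c * t) (cgen i).
  have [xi xc2] := refl_alt ic Mic; apply: refl_wle xi; rewrite -ex in xc2 *.
  by apply/(wle_genM xc2 Tc); rewrite !cgenK.
have Tj : refl (cgen c * t) (cgen j).
  have [yj yc2] := refl_alt jc Mjc; apply: refl_wle yj; rewrite -ey in yc2 *.
  by apply/(wle_genM yc2 Tc); rewrite !cgenK.
have [k [y [Mij e l]]] := alt_descents ij Ti Tj.
have Mji : M j i = Some k by rewrite coxeter_sym.
have k2' := coxeter_offdiag ij Mij; have k0 : k = k.-1.+1 by lia.
have e1 : cprod (i :: alt j i k.-1 ++ reduced_word y) = cgen c * t.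
  by rewrite -cat_cons -altS -k0 cprod_cat cprod_reduced_word.
have e2 : cprod (j :: alt i j k.-1 ++ reduced_word y) = cgen c * t.
  by rewrite -cat_cons -altS -k0 cprod_cat cprod_reduced_word (cprod_alt Mji).
exists k, (reduced_word y ++ v1); rewrite !catA; split=> //.
- apply: (head_rel_lift cm sw ic Mic hu hw1 xt tc tv) => //.
  by rewrite /reduced e1 l /= size_cat size_alt size_reduced_word -addSn -k0.
- apply: (head_rel_lift cm sw jc Mjc hv hw2 yt tc tv) => //.
  by rewrite /reduced e2 l /= size_cat size_alt size_reduced_word -addSn -k0.
Qed.

(** The outer induction on length supplies cancellation for shorter words, the inner one follows the
    chain of braid moves. *)
Lemma braid_cancellative m : cancellative m.
Proof.
elim: m => [//|m IH] i j u v su.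
move: {-1}(j :: v) (erefl (j :: v)) => z ez uz; elim: uz j v ez => {z} [|z w hz IHz st] j v e.
  by case: e => -> ->; rewrite /head_rel eqxx; apply: braid_eq_refl.
case: z hz IHz st => [/braid_eq_size//|c z] hz IHz st.
have sz := braid_eq_size hz.
apply: (head_rel_trans (c := c) (w := z) IH).
- by move: sz => /= [<-].
- exact: IHz.
by apply: head_rel_step; rewrite e.
Qed.

Theorem braid_lcm i j u v : braid_eq (i :: u) (j :: v) -> head_rel i u j v.
Proof. exact: (@braid_cancellative (size u).+1). Qed.

Theorem braid_cancel p u v : braid_eq (p ++ u) (p ++ v) -> braid_eq u v.
Proof. by apply: cancellative_catl (@braid_cancellative _) (leqnn _). Qed.

End BraidMonoid.

(** * Positive words embed in the Artin-Tits group *)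

Section ReverseBraids.
Variables (n : nat) (M : coxeterMatrix n).

Lemma rev_alt (i j : 'I_n) k : rev (alt i j k) = if odd k then alt i j k else alt j i k.
Proof.
elim: k => // k IH; rewrite {1}/alt mkseqS rev_rcons -/(alt i j k) IH !altS /=.
by case: (odd k).
Qed.

Lemma braid_eq_rev u v : braid_eq M u v -> braid_eq M (rev u) (rev v).
Proof.
elim=> [|v' w _ IH [p [q [i [j [k [ij Mij e ->]]]]]]]; first exact: braid_eq_refl.
apply: braid_eq_trans IH _; rewrite {}e !rev_cat; apply/braid_eq_catr/braid_eq_catl.
by rewrite !rev_alt; case: ifP => _; apply: braid_eq_alt; rewrite // coxeter_sym.
Qed.

End ReverseBraids.

Section ArtinGroup.
Variables (n : nat) (M : coxeterMatrix n).
Local Notation W := (coxeter_group M).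
Local Notation G := (artin M).
Local Notation cgen := (cgen M).
Local Notation cprod := (cprod M).
Local Notation braid_eq := (braid_eq M).
Local Notation gen := (gen M).
Implicit Types (i j : 'I_n) (u v w : seq 'I_n).
Variable w0 : W.
Hypothesis w0_top : forall x, wle x w0.

Let d := reduced_word w0.

Lemma cgen_inj : injective cgen.
Proof.
move=> i j e; case: (eqVneq i j) => // ij.
have : (cgen i * cgen j) ^+ 1 = 1 by rewrite e expg1 cgen_sq.
move=> /(cgenM_order_dvd ij (ltn0Sn 0))[k Mij].
by rewrite dvdn1 => /eqP k1; have := coxeter_offdiag ij Mij; rewrite k1.
Qed.

Lemma w0V : w0^-1 = w0.
Proof.
have e : clen w0 = (clen w0 + clen (w0 * w0))%N.
  by have := w0_top w0^-1; rewrite /wle clenV invgK.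
by apply/mulg1_eq/clen_eq0; lia.
Qed.

(** Maximality of [w0] applied to [cgen i * w0], whose length is one less, leaves a complement of
    length 1, that is, a generator. *)
Fact star_subproof i : exists j, cgen j = w0^-1 * cgen i * w0.
Proof.
have e : (clen (cgen i * w0)).+1 = (clen (cgen i * w0) + clen (w0^-1 * cgen i * w0))%N.
  by have := w0_top (cgen i * w0); rewrite /wle (clen_desc (refl_top w0_top i)) invgM cgenV.
have [w ew] := clen_word (w0^-1 * cgen i * w0).
have -> : clen (w0^-1 * cgen i * w0) = 1%N by lia.
by case: w ew => [|j [|]] // -> _; exists j; rewrite cprod_cons cprod_nil mulg1.
Qed.

Definition star i := projT1 (cid (star_subproof i)).

Lemma cgen_star i : cgen (star i) = w0^-1 * cgen i * w0.
Proof. by rewrite /star; case: cid. Qed.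

Lemma starK : involutive star.
Proof.
move=> i; apply: cgen_inj; have ww : w0 * w0 = 1 by rewrite -{1}w0V mulVg.
by rewrite !cgen_star w0V !mulgA ww mul1g -mulgA ww mulg1.
Qed.

Definition desc_top i := reduced_word (cgen i * w0).

Lemma braid_top_cons i : braid_eq d (i :: desc_top i).
Proof. exact: reduced_word_cons (refl_top w0_top i). Qed.

Lemma braid_top_rcons i : braid_eq d (desc_top i ++ [:: star i]).
Proof.
have e : cprod (desc_top i ++ [:: star i]) = w0.
  rewrite cprod_cat cprod_reduced_word cprod_cons cprod_nil mulg1 cgen_star.
  by rewrite -!mulgA mulVKg cgenK.
apply: matsumoto; rewrite ?e ?cprod_reduced_word //; first exact: reduced_reduced_word.
rewrite /reduced e size_cat size_reduced_word (clen_desc (refl_top w0_top i)).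
by rewrite addn1.
Qed.

Lemma braid_top_star i : braid_eq (i :: d) (d ++ [:: star i]).
Proof.
apply: braid_eq_trans (braid_eq_cons i (braid_top_rcons i)) _.
by rewrite -cat_cons; apply/braid_eq_catr/braid_eq_sym/braid_top_cons.
Qed.

Let z := d ++ d.

Lemma braid_top2_central i : braid_eq (i :: z) (z ++ [:: i]).
Proof.
apply: braid_eq_trans (braid_eq_catr d (braid_top_star i)) _.
rewrite /z -!catA; apply: braid_eq_catl => /=.
by rewrite -{2}(starK i); apply: braid_top_star.
Qed.

Definition cofactor i := desc_top i ++ d.

Lemma cofactorr i : braid_eq (i :: cofactor i) z.
Proof. by rewrite -cat_cons; apply/braid_eq_catr/braid_eq_sym/braid_top_cons. Qed.

(** Cancelling the first [i] in [i (cofactor i) i = z i = i z] turns the right complement into a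
    left one. *)
Lemma cofactorl i : braid_eq (cofactor i ++ [:: i]) z.
Proof.
apply: (braid_cancel w0_top (p := [:: i])) => /=.
apply: braid_eq_trans (braid_eq_sym (braid_top2_central i)).
by rewrite -cat_cons; apply/braid_eq_catr/cofactorr.
Qed.

Definition ztop k := flatten (nseq k z).

Lemma ztopD k l : ztop (k + l) = ztop k ++ ztop l.
Proof. by rewrite /ztop nseqD flatten_cat. Qed.

Lemma ztopC k u : braid_eq (u ++ ztop k) (ztop k ++ u).
Proof.
have zC v : braid_eq (v ++ z) (z ++ v).
  elim: v => [|i v IH]; first by rewrite cats0; apply: braid_eq_refl.
  apply: braid_eq_trans (braid_eq_cons i IH) _.
  by rewrite -(cat1s i v) catA; apply/(braid_eq_catr v (braid_top2_central i)).
elim: k => [|k IH]; first by rewrite cats0; apply: braid_eq_refl.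
rewrite /ztop /= -/(ztop k) catA; apply: braid_eq_trans (braid_eq_catr _ (zC u)) _.
by rewrite -(catA z u) -(catA z (ztop k)); apply/braid_eq_catl/IH.
Qed.

Lemma ztop_cancel k u v : braid_eq (u ++ ztop k) (v ++ ztop k) -> braid_eq u v.
Proof.
move=> e; apply: (braid_cancel w0_top (p := ztop k)).
apply: braid_eq_trans (braid_eq_sym (ztopC k u)) _.
exact: braid_eq_trans e (ztopC k v).
Qed.

Lemma ztop_swap k u v w : braid_eq (u ++ v ++ ztop k ++ w) (u ++ ztop k ++ v ++ w).
Proof. by apply: braid_eq_catl; rewrite !catA; apply/braid_eq_catr/ztopC. Qed.

(* Since [z] is central and divisible by every generator, a word over the
   generators and their inverses is equal in the group to the fraction
   [numer u / z ^ denom u]. *)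
Definition numer (u : word 'I_n) :=
  flatten [seq if l.2 then cofactor l.1 else [:: l.1] | l <- u].

Definition denom (u : word 'I_n) := count snd u.

Lemma numer_cat (u v : word 'I_n) : numer (u ++ v) = numer u ++ numer v.
Proof. by rewrite /numer map_cat flatten_cat. Qed.

Lemma numer_pos u : numer [seq (i, false) | i <- u] = u.
Proof. by rewrite /numer; elim: u => //= i u ->. Qed.

Lemma denom_pos u : denom [seq (i, false) | i <- u] = 0%N.
Proof. by rewrite /denom; elim: u => //= i u ->. Qed.

(** Equality of fractions by cross multiplication; transitivity is where cancellation in the braid
    monoid is indispensable. *)
Lemma fraction_wd (u v : word 'I_n) : word_eq (braid_rel M) u v ->
  braid_eq (numer u ++ ztop (denom v)) (numer v ++ ztop (denom u)).
Proof.
elim=> {u v} [u|u v _ IH|v u w _ IH1 _ IH2|u u' v v' _ IHu _ IHv|[i e]|u v].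
- exact: braid_eq_refl.
- exact: braid_eq_sym.
- apply: (@ztop_cancel (denom v)).
  have h1 := braid_eq_catr (ztop (denom w)) IH1; have h2 := braid_eq_catr (ztop (denom u)) IH2.
  rewrite -!catA -!ztopD in h1 h2 *.
  rewrite (addnC (denom w)) (addnC (denom u)); apply: braid_eq_trans h1 _.
  by rewrite (addnC (denom u) (denom w)).
- have dD r q : denom (r ++ q) = (denom r + denom q)%N by apply: count_cat.
  rewrite !numer_cat !dD !ztopD -!catA.
  apply: braid_eq_trans (ztop_swap _ _ _ _) _.
  apply: braid_eq_trans (braid_eq_sym (ztop_swap _ _ _ _)).
  by have := braid_eq_cat IHu IHv; rewrite -!catA.
- have h := cofactorl i; have h' := cofactorr i.
  by case: e; rewrite /numer /denom /ztop /= !cats0.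
move=> [i [j [k [ij Mij -> ->]]]].
by rewrite !alternatingE !numer_pos !denom_pos; apply/braid_eq_catr/braid_eq_alt.
Qed.

Definition gprod w : G := \prod_(i <- w) gen i.

Lemma gprodE w : gprod w = word_class _ [seq (i, false) | i <- w].
Proof. by rewrite word_class_pos. Qed.

Theorem gprodP u v : gprod u = gprod v <-> braid_eq u v.
Proof.
rewrite !gprodE; split=> [/word_classP/fraction_wd|].
  by rewrite !numer_pos !denom_pos !cats0.
elim=> // v' w _ -> [p [q [i [j [k [ij Mij -> ->]]]]]].
rewrite !map_cat !word_class_cat -!alternatingE; congr (_ * (_ * _)).
by apply/word_classP/word_eq_rel; exists i, j, k.
Qed.

End ArtinGroup.

(** * Lattice orders of Garside groups *)

(** Lcms are required only for two atoms, the lattice being derived from them. [gatom_sq] is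
    specific to the classical structure: [D] lifts a Coxeter element, so no square of an atom
    divides it. *)
Record garside (G : groupType) (P atom : set G) (D : G) (deg : G -> int) : Prop := Garside {
  gP1 : P 1;
  gPM : forall x y, P x -> P y -> P (x * y);
  gdegM : forall x y, deg (x * y) = (deg x + deg y)%R;
  gdeg_ge0 : forall x, P x -> (0 <= deg x)%R;
  gdeg_eq0 : forall x, P x -> deg x = 0%R -> x = 1;
  gatomP : forall a, atom a -> P a;
  gatom_deg : forall a, atom a -> deg a = 1%R;
  gatom_ex : forall x, P x -> x <> 1 -> exists2 a, atom a & P (a^-1 * x);
  gDP : P D;
  gPDl : forall x, P x -> P (D^-1 * x * D);
  gPDr : forall x, P x -> P (D * x * D^-1);
  gatomD : forall a, atom a -> P (a^-1 * D);
  gatom_sq : forall a, atom a -> ~ P ((a * a)^-1 * D);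
  glcm : forall a b, atom a -> atom b -> exists m,
    [/\ P (a^-1 * m), P (b^-1 * m) & forall p, P (a^-1 * p) -> P (b^-1 * p) -> P (m^-1 * p)];
  gbound : forall x, exists k, P (D ^+ k * x);
  gdegD : (2 <= deg D)%R }.

Section GarsideLattice.
Variables (G : groupType) (P atom : set G) (D : G) (deg : G -> int).
Hypothesis gar : garside P atom D deg.
Implicit Types (x y z : G) (k : nat).

Local Notation "x ≼ y" := (P (x^-1 * y)) (at level 70).
Local Notation "x ≼R y" := (P (y * x^-1)) (at level 70).

Let P1 := gP1 gar.
Let PD := gDP gar.
Let PM := gPM gar.
Let degM := gdegM gar.

Lemma deg1 : deg 1 = 0%R.
Proof. by apply: (@addrI _ (deg 1)); rewrite -degM mulg1 addr0. Qed.

Lemma degV x : deg x^-1 = (- deg x)%R.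
Proof. by apply/eqP; rewrite -addr_eq0 -degM mulVg deg1. Qed.

Lemma degX x k : deg (x ^+ k) = (deg x *+ k)%R.
Proof. by elim: k => [|k IH]; rewrite ?deg1 // expgS degM IH mulrS. Qed.

Lemma ple_refl x : x ≼ x.
Proof. by rewrite mulVg. Qed.

Lemma ple_trans y x z : x ≼ y -> y ≼ z -> x ≼ z.
Proof. by move=> xy yz; rewrite -(mulVKg y z) mulgA; apply: PM. Qed.

Lemma ple_deg x y : x ≼ y -> (deg x <= deg y)%R.
Proof. by move=> /(gdeg_ge0 gar); rewrite degM degV; lia. Qed.

Lemma ple_eq x y : x ≼ y -> (deg y <= deg x)%R -> x = y.
Proof.
move=> xy yx; have /(gdeg_eq0 gar xy) : deg (x^-1 * y) = 0%R.
  by have := gdeg_ge0 gar xy; rewrite degM degV; lia.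
by move=> /(congr1 (fun t => x * t)); rewrite mulVKg mulg1.
Qed.

Lemma ple_anti x y : x ≼ y -> y ≼ x -> x = y.
Proof. by move=> xy /ple_deg; apply: ple_eq. Qed.

Lemma ple_mul2l z x y : z * x ≼ z * y <-> x ≼ y.
Proof. by rewrite invgM -mulgA mulKg. Qed.

Lemma ple1 x : 1 ≼ x <-> P x.
Proof. by rewrite invg1 mul1g. Qed.

Lemma ple_pos x y : P x -> x ≼ y -> P y.
Proof. by move=> px xy; rewrite -(mulVKg x y); apply: PM. Qed.

Lemma pos_anti x : P x -> x ≼ 1 -> x = 1.
Proof. by move=> px x1; apply: esym; apply: ple_anti => //; rewrite ple1. Qed.

Lemma conjD x : P (D^-1 * x * D) <-> P x.
Proof.
split=> [/(gPDr gar)|/(gPDl gar)//].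
by rewrite -!mulgA mulVKg mulgV mulg1.
Qed.

Lemma conjDX k x : P (D ^- k * x * D ^+ k) <-> P x.
Proof.
elim: k x => [|k IH] x; first by rewrite expg0 invg1 mul1g mulg1.
have -> : D ^- k.+1 * x * D ^+ k.+1 = D^-1 * (D ^- k * x * D ^+ k) * D.
  by rewrite expgSr invgM !mulgA.
exact: iff_trans (conjD _) (IH x).
Qed.

Lemma conjDXV k x : P (D ^+ k * x * D ^- k) <-> P x.
Proof.
have e : D ^- k * (D ^+ k * x * D ^- k) * D ^+ k = x by rewrite -!mulgA mulKg mulVg mulg1.
by split=> [/(conjDX k)|h]; [rewrite e | apply/(conjDX k); rewrite e].
Qed.

(** [D] normalizes the positive monoid, so divisibility relations with its powers can be read on
    either side. *)
Lemma conjDXs k x : P (D ^- k * x) <-> P (x * D ^- k).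
Proof. by rewrite -{2}(mulVKg (D ^+ k) x); apply: iff_sym; apply: conjDXV. Qed.

Lemma conjDXp k x : P (x * D ^+ k) <-> P (D ^+ k * x).
Proof. by rewrite -{2}(mulgK (D ^+ k) x) mulgA; apply: iff_sym; apply: conjDXV. Qed.

Lemma conjDs x : D ≼ x <-> P (x * D^-1).
Proof. exact: (conjDXs 1). Qed.

Lemma ple_sle_DX k x : x ≼ D ^+ k <-> x ≼R D ^+ k.
Proof. exact: conjDXp. Qed.

Lemma ple_sle_D x : x ≼ D <-> x ≼R D.
Proof. exact: (conjDXp 1). Qed.

Lemma posDX k : P (D ^+ k).
Proof. by elim: k => [|k IH]; rewrite ?expgS //; apply: PM. Qed.

Lemma ple_DX k l : (k <= l)%N -> D ^+ k ≼ D ^+ l.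
Proof. by move=> kl; rewrite -(subnKC kl) expgnDr mulKg; apply: posDX. Qed.

Lemma ple_D_mull x y : P x -> D ≼ y -> D ≼ x * y.
Proof. by move=> px /conjDs Dy; apply/conjDs; rewrite -mulgA; apply: PM. Qed.

Lemma atomP x : atom x <-> P x /\ deg x = 1%R.
Proof.
split=> [ax|[px dx]]; first by split; [apply: (gatomP gar) | apply: (gatom_deg gar)].
have [|a aa ax] := gatom_ex gar px; first by move=> e; move: dx; rewrite e deg1.
by rewrite -(ple_eq ax) // dx (gatom_deg gar aa).
Qed.

Lemma ple_atom a x : atom a -> P x -> x ≼ a -> x = 1 \/ x = a.
Proof.
move=> aa px xa; case: (eqVneq x 1) => [|/eqP x1]; first by left.
right; apply: ple_eq => //; rewrite (gatom_deg gar aa).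
have := gdeg_ge0 gar px; have : deg x <> 0%R by move/(gdeg_eq0 gar px).
lia.
Qed.

Lemma sle_atom a x : atom a -> P x -> x ≼R a -> x = 1 \/ x = a.
Proof.
move=> aa px xa; case: (eqVneq x 1) => [|/eqP x1]; first by left.
right; have ax : P (a * x^-1) := xa.
have : (a * x^-1) = 1.
  apply: (gdeg_eq0 gar ax); have := gdeg_ge0 gar ax; rewrite degM degV (gatom_deg gar aa).
  have := gdeg_ge0 gar px; have : deg x <> 0%R by move/(gdeg_eq0 gar px).
  lia.
by move=> /(congr1 (fun t => t * x)); rewrite mulgVK mul1g.
Qed.

Lemma atom_conj a : atom a -> atom (D^-1 * a * D).
Proof.
move=> aa; have [pa da] := (atomP a).1 aa; apply/atomP; split; first exact/conjD.
by rewrite !degM degV da; lia.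
Qed.

Lemma atom_conjX k a : atom a -> atom (D ^- k * a * D ^+ k).
Proof.
move=> aa; have [pa da] := (atomP a).1 aa; apply/atomP; split; first exact/conjDX.
by rewrite !degM degV da; lia.
Qed.

Lemma ple_DX_ex x : exists k, x ≼ D ^+ k.
Proof. by have [k hk] := gbound gar x^-1; exists k; apply/conjDXp. Qed.

(* Least upper bounds of divisors of [p], by induction on [p]: the lcm of two
   atoms allows to reduce to elements with a common first atom. *)
Lemma join_below m p x y : P p -> (deg p < m%:Z)%R -> P x -> P y -> x ≼ p -> y ≼ p ->
  exists u, [/\ x ≼ u, y ≼ u & forall z, x ≼ z -> y ≼ z -> u ≼ z].
Proof.
elim: m p x y => [|m IH] p x y pp dp px py xp yp.
  by have := gdeg_ge0 gar pp; lia.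
have common a x' y' : atom a -> a ≼ x' -> a ≼ y' -> x' ≼ p -> y' ≼ p ->
    exists u, [/\ x' ≼ u, y' ≼ u & forall z, x' ≼ z -> y' ≼ z -> u ≼ z].
  move=> aa ax ay xp' yp'.
  have da : deg (a^-1 * p) = (deg p - 1)%R by rewrite degM degV (gatom_deg gar aa); lia.
  have dp' : (deg (a^-1 * p) < m%:Z)%R by lia.
  have xp2 : a^-1 * x' ≼ a^-1 * p by apply/ple_mul2l.
  have yp2 : a^-1 * y' ≼ a^-1 * p by apply/ple_mul2l.
  have [u [h1 h2 h3]] := IH _ _ _ (ple_trans ax xp') dp' ax ay xp2 yp2.
  exists (a * u); split.
  - by rewrite -(mulVKg a x'); apply/ple_mul2l.
  - by rewrite -(mulVKg a y'); apply/ple_mul2l.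
  move=> z xz yz; rewrite -(mulVKg a z); apply/ple_mul2l.
  by apply: h3; apply/ple_mul2l.
have [->|/(gatom_ex gar px)[a aa ax]] := EM (x = 1).
  by exists y; split=> //; [apply/ple1 | apply: ple_refl].
have [->|/(gatom_ex gar py)[b ab By]] := EM (y = 1).
  by exists x; split=> //; [apply: ple_refl | apply/ple1].
have [l [al bl ml]] := glcm gar aa ab.
have lp : l ≼ p by apply: ml; [apply: ple_trans xp | apply: ple_trans yp].
have [u1 [xu1 lu1 m1]] := common a x l aa ax al xp lp.
have [u2 [yu2 lu2 m2]] := common b y l ab By bl yp lp.
have [||u [h1 h2 h3]] := common a u1 u2 aa (ple_trans ax xu1) (ple_trans al lu2).
- exact: m1.
- exact: m2.
exists u; split; [exact: ple_trans h1 | exact: ple_trans h2 |].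
move=> z xz yz; have lz : l ≼ z by apply: ml; [apply: ple_trans xz | apply: ple_trans yz].
by apply: h3; [apply: m1 | apply: m2].
Qed.

Lemma join_ex x y : exists u, [/\ x ≼ u, y ≼ u & forall z, x ≼ z -> y ≼ z -> u ≼ z].
Proof.
have [k1 h1] := gbound gar x; have [k2 h2] := gbound gar y.
set c := D ^+ (k1 + k2).
have px : P (c * x).
  by rewrite /c addnC expgnDr -mulgA; apply: PM => //; apply: posDX.
have py : P (c * y) by rewrite /c expgnDr -mulgA; apply: PM => //; apply: posDX.
have [l1 H1] := ple_DX_ex (c * x); have [l2 H2] := ple_DX_ex (c * y).
set p := D ^+ (l1 + l2).
have xp : c * x ≼ p by apply: ple_trans H1 _; apply: ple_DX; apply: leq_addr.
have yp : c * y ≼ p by apply: ple_trans H2 _; apply: ple_DX; apply: leq_addl.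
have pp : P p by apply: posDX.
have [|u [a1 a2 a3]] := @join_below `|deg p|.+1 p (c * x) (c * y) pp _ px py xp yp.
  by have := gdeg_ge0 gar pp; lia.
exists (c^-1 * u); split; try by apply/(ple_mul2l c); rewrite mulVKg.
move=> z xz yz; apply/(ple_mul2l c); rewrite mulVKg.
by apply: a3; apply/ple_mul2l.
Qed.

(** A common lower bound of maximal degree is greatest: its join with another lower bound is again a
    lower bound, hence of the same degree and equal to it. *)
Lemma meet_ex x y : exists u, [/\ u ≼ x, u ≼ y & forall z, z ≼ x -> z ≼ y -> z ≼ u].
Proof.
have [k1 h1] := gbound gar x; have [k2 h2] := gbound gar y.
pose Q (k : nat) := `[< exists d, [/\ d ≼ x, d ≼ y & deg d = (deg x - k%:Z)%R] >].
have Qex : exists k, Q k.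
  set d := D ^- (k1 + k2).
  have dx : d ≼ x by rewrite /d invgK addnC expgnDr -mulgA; apply: PM => //; apply: posDX.
  have dy : d ≼ y by rewrite /d invgK expgnDr -mulgA; apply: PM => //; apply: posDX.
  exists `|deg x - deg d|%N; apply/asboolP; exists d; split=> //.
  by have := ple_deg dx; lia.
have [k /asboolP[d [dx dy dk]] kmin] := ex_minnP Qex.
exists d; split=> // e ex ey; have [u [du eu hu]] := join_ex d e.
have ux := hu x dx ex; have uy := hu y dy ey.
rewrite (@ple_eq d u) //.
have /kmin : Q `|deg x - deg u|%N.
  by apply/asboolP; exists u; split=> //; have := ple_deg ux; lia.
by have := ple_deg ux; lia.
Qed.

(** Inversion carries the suffix order to the reversed prefix order. *)
Lemma smeet_ex x y : exists u, [/\ u ≼R x, u ≼R y & forall z, z ≼R x -> z ≼R y -> z ≼R u].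
Proof.
have [u [h1 h2 h3]] := join_ex x^-1 y^-1; exists u^-1; rewrite !invgK in h1 h2 *.
by split=> // z zx zy; apply: h3; rewrite invgK.
Qed.

Lemma sjoin_ex x y : exists u, [/\ x ≼R u, y ≼R u & forall z, x ≼R z -> y ≼R z -> u ≼R z].
Proof.
have [u [h1 h2 h3]] := meet_ex x^-1 y^-1; exists u^-1; split=> //.
move=> z xz yz; have := h3 z^-1; rewrite !invgK; exact.
Qed.

(** Removing the greatest simple prefix lowers the supremum, because [x * D ^- k] is below both [x]
    and [D]. That element need not be positive, so the maximality of [s] ranges over all of [G]. *)
Lemma ple_greedy k x s : x ≼ D ^+ k.+1 -> s ≼ x -> s ≼ D ->
  (forall z, z ≼ x -> z ≼ D -> z ≼ s) -> s^-1 * x ≼ D ^+ k.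
Proof.
move=> xD sx sD smax.
have : x * D ^- k ≼ s.
  apply: smax; rewrite invgM invgK.
    by rewrite mulgVK; apply: posDX.
  by rewrite -mulgA; apply/conjDXp; rewrite -mulgA -expgS.
by rewrite invgM invgK => h; rewrite invgM invgK; apply/conjDXp; rewrite mulgA.
Qed.

Lemma sle_greedy k x s : x ≼ D ^+ k.+1 -> s ≼R x -> s ≼R D ->
  (forall z, z ≼R x -> z ≼R D -> z ≼R s) -> x * s^-1 ≼ D ^+ k.
Proof.
move=> xD sx sD smax; rewrite invgM invgK.
have : D ^- k * x ≼R s.
  apply: smax; rewrite invgM invgK; first by rewrite mulVKg; apply: posDX.
  by apply/(conjDXp 1); rewrite -mulgA -expgSr.
by rewrite invgM invgK mulgA.
Qed.

End GarsideLattice.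

(** * The classical Garside structure *)

Lemma longest_exists n (M : coxeterMatrix n) : spherical M ->
  exists w0 : coxeter_group M, forall x, wle x w0.
Proof.
move=> /finite_seqP[s sE].
pose Q k := `[< exists x : coxeter_group M, clen x = k >].
have Qex : exists k, Q k by exists (clen (1 : coxeter_group M)); apply/asboolP; exists 1.
have Qle k : Q k -> (k <= \max_(y <- s) clen y)%N.
  move=> /asboolP[x <-]; apply: (leq_bigmax_seq (P := predT) (F := @clen n M)) => //.
  by have : ([set` s] x)%classic by rewrite -sE.
have [k /asboolP[w0 <-] kmax] := ex_maxnP Qex Qle.
exists w0; apply: clen_top => i; apply: contraT => /clen_asc e.
have /kmax : Q (clen (cgen M i * w0)) by apply/asboolP; exists (cgen M i * w0).
by rewrite e ltnn.
Qed.

(** * The degree homomorphism *)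

Section Degree.
Variables (n : nat) (M : coxeterMatrix n).
Local Notation G := (artin M).

Definition word_deg (u : word 'I_n) : int := (\sum_(l <- u) (if l.2 then -1 else 1))%R.

Lemma word_deg_cat u v : word_deg (u ++ v) = (word_deg u + word_deg v)%R.
Proof. exact: big_cat. Qed.

Lemma word_deg_pos w : word_deg [seq (i, false) | i <- w] = (size w)%:Z%R.
Proof.
by rewrite /word_deg big_map /= big_const_seq count_predT iter_addr_0 -mulr_natl mulr1 natz.
Qed.

Lemma word_deg_wd u v : word_eq (braid_rel M) u v -> word_deg u = word_deg v.
Proof.
elim=> {u v} [//|u v _ -> //|v u w _ -> _ -> //|u u' v v' _ e1 _ e2|[i e]|u v].
- by rewrite !word_deg_cat e1 e2.
- by rewrite /word_deg big_cons big_seq1 big_nil /=; case: e; rewrite ?addNr ?subrr.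
move=> [i [j [k [_ _ -> ->]]]].
by rewrite !alternatingE !word_deg_pos !size_alt.
Qed.

Definition adeg (x : G) : int := word_deg (repr x).

Lemma adeg_word_class u : adeg (word_class _ u) = word_deg u.
Proof. by apply: word_deg_wd; apply: repr_word_class. Qed.

Lemma adegM x y : adeg (x * y) = (adeg x + adeg y)%R.
Proof.
by rewrite -[x]word_classK -[y]word_classK -word_class_cat !adeg_word_class word_deg_cat.
Qed.

Lemma adeg_gprod w : adeg (gprod M w) = (size w)%:Z%R.
Proof. by rewrite gprodE adeg_word_class word_deg_pos. Qed.

End Degree.

(** * The Garside axioms for the positive monoid *)

Section ArtinGarside.
Variables (n : nat) (M : coxeterMatrix n).
Local Notation W := (coxeter_group M).
Local Notation G := (artin M).
Local Notation gen := (gen M).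
Local Notation gprod := (gprod M).
Implicit Types (i j : 'I_n) (u v w : seq 'I_n) (x y : G).
Variable w0 : W.
Hypothesis w0_top : forall t : W, wle t w0.

Local Notation P := (positive M).
Local Notation star := (star w0_top).

Definition gtop : G := gprod (reduced_word w0).

Lemma gprod_cons i w : gprod (i :: w) = gen i * gprod w.
Proof. exact: big_cons. Qed.

Lemma gprod_cat u v : gprod (u ++ v) = gprod u * gprod v.
Proof. exact: big_cat. Qed.

Lemma gprod1 i : gprod [:: i] = gen i.
Proof. exact: big_seq1. Qed.

Lemma gprod_nil : gprod [::] = 1.
Proof. exact: big_nil. Qed.

Lemma pos_gprod w : P (gprod w).
Proof. by exists w. Qed.

Lemma pos_mul x y : P x -> P y -> P (x * y).
Proof. by move=> [u ->] [v ->]; exists (u ++ v); rewrite big_cat. Qed.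

Lemma gen_top i : gen i * gtop = gtop * gen (star i).
Proof.
rewrite -gprod_cons -gprod1 -gprod_cat; apply/(gprodP w0_top).
exact: (braid_top_star w0_top).
Qed.

Lemma conj_top_gen i : gtop^-1 * gen i * gtop = gen (star i).
Proof. by rewrite -mulgA gen_top mulKg. Qed.

Lemma conj_topV_gen i : gtop * gen i * gtop^-1 = gen (star i).
Proof. by rewrite -{1}(starK w0_top i) -gen_top mulgK. Qed.

Lemma pos_conj_top x : P x -> P (gtop^-1 * x * gtop).
Proof.
move=> [w ->]; exists (map star w); rewrite big_map.
elim: w => [|i w IH]; first by rewrite !big_nil mulg1 mulVg.
rewrite !big_cons -IH -conj_top_gen -!mulgA; congr (_ * (_ * _)).
by rewrite mulVKg.
Qed.

Lemma pos_conjV_top x : P x -> P (gtop * x * gtop^-1).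
Proof.
move=> [w ->]; exists (map star w); rewrite big_map.
elim: w => [|i w IH]; first by rewrite !big_nil mulg1 mulgV.
rewrite !big_cons -IH -conj_topV_gen -!mulgA; congr (_ * (_ * _)).
by rewrite mulKg.
Qed.

Lemma gen_pre_top i : P ((gen i)^-1 * gtop).
Proof.
exists (desc_top w0 i); apply: (mulgI (gen i)); rewrite mulVKg.
by rewrite -[RHS]gprod_cons; apply/(gprodP w0_top)/(braid_top_cons w0_top).
Qed.

Lemma gen_suf_top i : P (gtop * (gen i)^-1).
Proof.
exists (desc_top w0 (star i)); apply: (mulIg (gen i)); rewrite mulgVK.
rewrite -{2}(starK w0_top i) -gprod1 -[RHS]gprod_cat.
by apply/(gprodP w0_top)/(braid_top_rcons w0_top).
Qed.

(** All positive words for [gtop] have size [clen w0], but one starting with [i i] becomes shorter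
    in the Coxeter group. *)
Lemma gen_sq_top i : ~ P ((gen i * gen i)^-1 * gtop).
Proof.
move=> [v e]; have : gtop = gprod [:: i, i & v].
  by rewrite !gprod_cons mulgA -[gprod v]e mulVKg.
move=> /(gprodP w0_top) h; have := braid_eq_cprod h; have := braid_eq_size h.
rewrite cprod_reduced_word !cprod_cons cgenK size_reduced_word => /= + ew.
by have := clen_le M v; rewrite -ew => + e1; rewrite e1; lia.
Qed.

Lemma gen_lcm i j : exists m, [/\ P ((gen i)^-1 * m), P ((gen j)^-1 * m) &
  forall p, P ((gen i)^-1 * p) -> P ((gen j)^-1 * p) -> P (m^-1 * p)].
Proof.
case: (eqVneq i j) => [->|ij].
  by exists (gen j); rewrite mulVg; split=> //; exists [::]; rewrite big_nil.
have [k Mij] := coxeter_finite w0_top i j; have k2 := coxeter_offdiag ij Mij.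
have k0 : k = k.-1.+1 by lia.
have ealt : gprod (alt i j k) = gprod (alt j i k) by apply/(gprodP w0_top)/braid_eq_alt.
exists (gprod (alt i j k)); split.
- by rewrite k0 altS gprod_cons mulKg; apply: pos_gprod.
- by rewrite ealt k0 altS gprod_cons mulKg; apply: pos_gprod.
move=> p [u eu] [v ev].
have {}eu : p = gprod (i :: u) by rewrite gprod_cons -[gprod u]eu mulVKg.
have {}ev : p = gprod (j :: v) by rewrite gprod_cons -[gprod v]ev mulVKg.
have /(gprodP w0_top)/(braid_lcm w0_top) : gprod (i :: u) = gprod (j :: v) by rewrite -eu -ev.
rewrite /head_rel (negbTE ij) => -[k' [w [+ hu _]]]; rewrite Mij => -[ek]; subst k'.
exists w; rewrite eu; apply: (mulgI (gprod (alt i j k))); rewrite mulVKg.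
rewrite -[RHS]gprod_cat; apply/(gprodP w0_top).
by rewrite k0 altS; apply: braid_eq_cons.
Qed.

Lemma top_bound x : exists k, P (gtop ^+ k * x).
Proof.
rewrite -[x]word_classK; elim: (repr x) => [|[i e] u [k IH]].
  by exists 0%N; rewrite word_class_nil mulg1 expg0; exists [::]; rewrite big_nil.
have conj l y : P y -> P (gtop ^+ l * y * gtop ^- l).
  elim: l y => [|l IHl] y py; first by rewrite expg0 invg1 mulg1 mul1g.
  have -> : gtop ^+ l.+1 * y * gtop ^- l.+1 = gtop ^+ l * (gtop * y * gtop^-1) * gtop ^- l.
    by rewrite expgSr invgM !mulgA.
  exact/IHl/pos_conjV_top.
have -> : word_class (braid_rel M) ((i, e) :: u)
    = (if e then (gen i)^-1 else gen i) * word_class _ u.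
  by rewrite -cat1s word_class_cat; case: e => //; rewrite word_class_neg.
set g := if e then _ else _; have [m pm] : exists m, P (gtop ^+ m * g).
  rewrite /g; case: (e); first by exists 1%N; apply: gen_suf_top.
  by exists 0%N; rewrite mul1g -gprod1; apply: pos_gprod.
exists (k + m)%N.
have -> : gtop ^+ (k + m) * (g * word_class _ u)
    = (gtop ^+ k * (gtop ^+ m * g) * gtop ^- k) * (gtop ^+ k * word_class _ u).
  by rewrite expgnDr -!mulgA mulKg.
by apply: pos_mul => //; apply: conj.
Qed.

Lemma size_top : (2 <= clen w0)%N.
Proof.
have [i [j [ij _]]] := coxeter_nontrivial M.
have [k [y [Mij _ ->]]] := alt_descents ij (refl_top w0_top i) (refl_top w0_top j).
by have := coxeter_offdiag ij Mij; lia.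
Qed.

Lemma artin_garside : garside P (atoms M) gtop (@adeg n M).
Proof.
split.
- by exists [::]; rewrite big_nil.
- exact: pos_mul.
- exact: adegM.
- by move=> _ [w ->]; rewrite -/(gprod w) adeg_gprod.
- by move=> _ [w ->]; rewrite -/(gprod w) adeg_gprod => -[/size0nil ->]; rewrite gprod_nil.
- by move=> _ [i _ <-]; rewrite -gprod1; apply: pos_gprod.
- by move=> _ [i _ <-]; rewrite -gprod1 adeg_gprod.
- move=> _ [[|i w] ->]; first by rewrite big_nil.
  by move=> _; exists (gen i); [exists i | rewrite big_cons mulKg; exists w].
- exact: pos_gprod.
- exact: pos_conj_top.
- exact: pos_conjV_top.
- by move=> _ [i _ <-]; apply: gen_pre_top.
- by move=> _ [i _ <-]; apply: gen_sq_top.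
- by move=> _ _ [i _ <-] [j _ <-]; apply: gen_lcm.
- exact: top_bound.
- by rewrite adeg_gprod size_reduced_word; have := size_top; lia.
Qed.

(** A longest Coxeter element whose lift divides [u] can be bounded together with each generator
    inside [W]; by maximality it already has all of them as descents, so it is [w0]. *)
Lemma top_lub_word u : (forall i, exists v, gprod u = gprod (i :: v)) ->
  exists v, gprod u = gtop * gprod v.
Proof.
move=> hu; pose Q k := `[< exists2 t : W, lift_dvd t u & clen t = k >].
have Qex : exists k, Q k.
  exists 0%N; apply/asboolP; exists 1; last exact: clen1.
  by exists u; rewrite reduced_word1; apply: braid_eq_refl.
have Qle k : Q k -> (k <= size u)%N.
  move=> /asboolP[t [v /braid_eq_size <-] <-].
  by rewrite size_cat size_reduced_word leq_addr.
have [k /asboolP[t tu tk] kmax] := ex_maxnP Qex Qle.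
have ti i : refl t (cgen M i).
  have iu : lift_dvd (cgen M i) u.
    have [v /(gprodP w0_top) e] := hu i; exists v; apply: braid_eq_trans (braid_eq_sym e).
    rewrite -(cat1s i v); apply: braid_eq_catr; apply: matsumoto.
    - exact: reduced_reduced_word.
    - by rewrite /reduced cprod_cons cprod_nil mulg1 clen_gen.
    - by rewrite cprod_reduced_word cprod_cons cprod_nil mulg1.
  have [t' [tt' it' _ t'u]] :=
    lift_dvd_bound w0_top (braid_cancellative w0_top (m := _)) (leqnn _) (w0_top t) (w0_top (cgen M i)) tu iu.
  have /kmax h : Q (clen t') by apply/asboolP; exists t'.
  have e : t^-1 * t' = 1 by apply: clen_eq0; move: tt'; rewrite /wle; lia.
  by rewrite -(mulg1 t) -e mulVKg; apply/wle_gen.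
have et : t = w0.
  have h1 := clen_top ti w0; have h2 := w0_top t.
  have e : clen (t^-1 * w0) = 0%N by move: h1 h2; rewrite /wle; lia.
  by rewrite -(mulg1 t) -(clen_eq0 e) mulVKg.
move: tu; rewrite et => -[v e]; exists v; rewrite -gprod_cat.
by apply/(gprodP w0_top)/braid_eq_sym.
Qed.

Lemma top_is_lub : is_lub_for (@pre_le n M) (atoms M) gtop.
Proof.
split=> [_ [i _ <-]|e he]; first exact: gen_pre_top.
have [i0 _] := coxeter_nontrivial M.
have hi i : exists v, e = gprod (i :: v).
  have [v ev] := he (gen i) (imageT gen i).
  by exists v; rewrite gprod_cons -[gprod v]ev mulVKg.
have [u eu] := hi i0; have [|v ev] := @top_lub_word (i0 :: u).
  by move=> i; rewrite -eu.
by exists v; rewrite eu ev mulKg.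
Qed.

Lemma top_rev : braid_eq M (rev (reduced_word w0)) (reduced_word w0).
Proof.
have e : cprod M (rev (reduced_word w0)) = w0 by rewrite cprod_rev cprod_reduced_word w0V.
apply: matsumoto; rewrite ?e ?cprod_reduced_word //; last exact: reduced_reduced_word.
by rewrite /reduced e size_rev size_reduced_word.
Qed.

Lemma top_is_rlub : is_lub_for (@suf_le n M) (atoms M) gtop.
Proof.
split=> [_ [i _ <-]|e he]; first exact: gen_suf_top.
have [i0 _] := coxeter_nontrivial M.
have hi i : exists v, e = gprod (rcons v i).
  have [v ev] := he (gen i) (imageT gen i).
  by exists v; rewrite -cats1 gprod_cat gprod1 -[gprod v]ev mulgVK.
have [u eu] := hi i0; have [|v ev] := @top_lub_word (rev (rcons u i0)).
  move=> i; have [v ev] := hi i; exists (rev v).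
  rewrite -rev_rcons; apply/(gprodP w0_top)/braid_eq_rev/(gprodP w0_top).
  by rewrite -eu.
exists (rev v); apply: (mulIg gtop); rewrite mulgVK eu.
rewrite -[RHS]gprod_cat; apply/(gprodP w0_top).
move: ev; rewrite -gprod_cat => /(gprodP w0_top)/braid_eq_rev.
rewrite revK rev_cat => /braid_eq_trans; apply.
by apply/braid_eq_catl/top_rev.
Qed.

Lemma DeltaE : Delta M = gtop.
Proof.
rewrite /Delta; case: xgetP => [y -> [hy _]|/(_ gtop)]; last first.
  by case; split; [apply: top_is_lub | apply: top_is_rlub].
have [a1 a2] := hy; have [b1 b2] := top_is_lub.
by apply: (ple_anti artin_garside); [apply: a2 | apply: b2].
Qed.

End ArtinGarside.

Theorem Delta_garside n (M : coxeterMatrix n) : spherical M ->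
  garside (positive M) (atoms M) (Delta M) (@adeg n M).
Proof.
by move=> /longest_exists[w0 w0_top]; rewrite (DeltaE w0_top); apply: artin_garside.
Qed.

(** * Absorption *)

Section Absorption.
Variables (G : groupType) (P atom : set G) (D : G) (deg : G -> int).
Hypothesis gar : garside P atom D deg.
Implicit Types (x y z u v w : G) (k m : nat).

Local Notation "x ≼ y" := (P (x^-1 * y)) (at level 70).
Local Notation "x ≼R y" := (P (y * x^-1)) (at level 70).

Let PM := gPM gar.
Let degM := gdegM gar.
Let ple_trans := ple_trans gar.

(** Absorption normalized to a left factor of infimum 0: the infimum stays 0, and every power of [D]
    bounding [u] still bounds the product. *)
Definition absorbs u z :=
  [/\ P u, P z, ~ D ≼ u * z & forall k, u ≼ D ^+ k -> u * z ≼ D ^+ k].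

(* Multiplying by an atom never raises both [inf] and [sup]. *)
Lemma absorbs_coatom a u : atom a -> ~ absorbs u (D * a^-1).
Proof.
move=> aa [pu pz inf0 sup].
have da := gatom_deg gar aa; have dD := gdegD gar.
have [k /asboolP hk kmin] := ex_minnP (let: ex_intro k h := ple_DX_ex gar u in
  ex_intro (fun k => `[< u ≼ D ^+ k >]) k (asboolT h)).
have := sup k hk; case: k hk kmin => [|k] hk kmin hz.
  have u1 := pos_anti gar pu hk; move: hz; rewrite u1 mul1g => /(pos_anti gar pz).
  by move=> /(congr1 deg); rewrite degM (degV gar) (deg1 gar) da; lia.
(* The greatest simple suffix [s] of the product contains [D * a^-1], so by degree it is that
   element or [D]. The second contradicts the infimum; in the first, removing [s] gives back [u]
   with a smaller supremum. *)
have [s [sh sD smax]] := smeet_ex gar (u * (D * a^-1)) D.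
have hs := sle_greedy gar hz sh sD smax.
have e1 : P (s * (D * a^-1)^-1).
  apply: smax; first by rewrite mulgK.
  by rewrite invgM invgK mulgA; apply/(gPDr gar)/(gatomP gar).
have := gdeg_ge0 gar e1; have := gdeg_ge0 gar sD; rewrite !degM !(degV gar) degM (degV gar) da.
have [d1|d1] := EM (deg s = deg D).
  have sDe : s = D.
    apply: (ple_eq gar); last by rewrite d1.
    exact/(ple_sle_D gar).
  by move=> _ _; apply: inf0; apply/(conjDs gar); rewrite sDe in sh.
move=> h2 h3.
have : s * (D * a^-1)^-1 = 1.
  by apply: (gdeg_eq0 gar e1); rewrite !degM !(degV gar) degM (degV gar) da; lia.
move=> /(congr1 (fun t => t * (D * a^-1))); rewrite mulgVK mul1g => es.
move: hs; rewrite es mulgK => hs.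
by have := kmin k (asboolT hs); rewrite ltnn.
Qed.

Lemma absorbs_factor u x y z : P x -> P y -> P z -> absorbs u (x * y * z) -> absorbs (u * x) y.
Proof.
move=> px py pz [pu _ inf0 sup].
have e : u * (x * y * z) = u * x * y * z by rewrite !mulgA.
have xyz k : u * (x * y * z) ≼ D ^+ k -> u * x * y ≼ D ^+ k.
  by apply: ple_trans; rewrite e mulKg.
split=> //; first exact: PM.
  by move=> h; apply: inf0; rewrite e mulgA; apply: PM.
move=> k xk; apply/xyz/sup; apply: ple_trans xk.
by rewrite mulKg.
Qed.

Definition moves y := P y /\ (y ≼ D \/ exists u, absorbs u y).

Lemma moves_factor x y z : P x -> P y -> P z -> moves (x * y * z) -> moves y.
Proof.
move=> px py pz [_ [h|[u h]]]; split=> //; last first.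
  by right; exists (u * x); apply: absorbs_factor h.
left.
have xyD : x * y ≼ D by apply: ple_trans h; rewrite mulKg.
apply/(ple_sle_D gar); have := (ple_sle_D gar (x * y)).1 xyD.
by rewrite invgM mulgA => h'; rewrite -(mulgVK x (D * y^-1)); apply: PM.
Qed.

Lemma moves_conj c y : commute c D -> (forall x, P (c * x * c^-1) <-> P x) ->
  moves y -> moves (c * y * c^-1).
Proof.
move=> cD cP [py h]; split; first exact/cP.
have cDX k : c^-1 * D ^+ k = D ^+ k * c^-1.
  by apply/commute_sym/commuteV/commute_sym/commuteX.
have cX x k : c * x * c^-1 ≼ D ^+ k <-> x ≼ D ^+ k.
  have -> : (c * x * c^-1)^-1 * D ^+ k = c * (x^-1 * D ^+ k) * c^-1.
    by rewrite !invgM !invgK -!mulgA cDX.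
  exact: cP.
case: h => [h|[u [pu _ inf0 sup]]]; first by left; apply/(cX y 1%N).
right; exists (c * u * c^-1).
have e : c * u * c^-1 * (c * y * c^-1) = c * (u * y) * c^-1 by rewrite -!mulgA mulKg.
split; [exact/cP | exact/cP | | by move=> k /cX /sup; rewrite e => /cX].
rewrite e => h; apply: inf0; apply/cP; move: h.
have -> : D^-1 * (c * (u * y) * c^-1) = c * (D^-1 * (u * y)) * c^-1 => //.
by rewrite !mulgA; congr (_ * _ * _ * _); apply/commute_sym/commuteV.
Qed.

Lemma moves_conjDX m y : moves y -> moves (D ^+ m * y * D ^- m).
Proof.
apply: moves_conj; first exact/commute_sym/commuteX/commute_refl.
by move=> x; apply: (conjDXV gar).
Qed.

(** The gcd [z1] of [z] and [D ^+ m] already produces the whole power of [D], since [w^-1 * D ^+ m]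
    is below both. *)
Lemma split_top m w z : P w -> P z -> D ^+ m ≼ w * z -> exists z1 z2 p,
  [/\ z = z1 * z2, P z1 /\ P z2, w * z1 = p * D ^+ m, P p & z1 ≼ D ^+ m].
Proof.
move=> pw pz h; have [z1 [h1 h2 h3]] := meet_ex gar z (D ^+ m).
have pz1 : P z1 by apply/(ple1 P z1)/h3; rewrite invg1 mul1g //; apply: (posDX gar).
exists z1, (z1^-1 * z), (w * z1 * D ^- m); split=> //.
- by rewrite mulVKg.
- by rewrite mulgVK.
apply/(conjDXs gar); rewrite mulgA.
have := h3 (w^-1 * D ^+ m); rewrite !invgM !invgK; apply=> //.
  by rewrite -mulgA.
by rewrite -mulgA; apply/(conjDXs gar); rewrite mulgK.
Qed.

Lemma inf_ex x : P x -> exists m v, [/\ x = v * D ^+ m, P v & ~ D ≼ v].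
Proof.
elim: {x}`|deg x|%N {-2}x (leqnn `|deg x|%N) => [|l IH] x lx px; have dx := gdeg_ge0 gar px.
  exists 0%N, x; split=> //; first by rewrite mulg1.
  by move=> /(ple_deg gar); have := gdegD gar; lia.
have [Dx|Dx] := EM (D ≼ x); last by exists 0%N, x; rewrite mulg1.
have [||m [v [e pv Dv]]] := IH (x * D^-1).
- have := ple_deg gar Dx; have := gdegD gar; rewrite degM (degV gar); lia.
- exact/(conjDs gar).
exists m.+1, v; split=> //; rewrite expgSr mulgA -e mulgVK //.
Qed.

Lemma inf_uniq_le p v k m : P p -> ~ D ≼ v -> p * D ^+ k = v * D ^+ m -> (k <= m)%N.
Proof.
move=> pp Dv e; rewrite leqNgt; apply/negP => mk; apply: Dv.
have -> : v = p * D ^+ (k - m).-1 * D.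
  apply: (mulIg (D ^+ m)); rewrite -e -!mulgA; congr (_ * _).
  by rewrite mulgA -expgSr -expgnDr; congr (_ ^+ _); lia.
by apply/(conjDs gar); rewrite mulgK; apply: PM => //; apply: (posDX gar).
Qed.

Lemma inf_uniq p v k m : P p -> P v -> ~ D ≼ p -> ~ D ≼ v ->
  p * D ^+ k = v * D ^+ m -> k = m /\ p = v.
Proof.
move=> pp pv Dp Dv e.
have km : k = m.
  by apply/eqP; rewrite eqn_leq (inf_uniq_le pp Dv e) (inf_uniq_le pv Dp (esym e)).
by split=> //; apply: (mulIg (D ^+ m)); rewrite -{1}km.
Qed.

End Absorption.

(** * The axis *)

Section Axis.
Variables (G : groupType) (P atom : set G) (D : G) (deg : G -> int).
Hypothesis gar : garside P atom D deg.
Implicit Types (x y z u v w s t : G) (k m : nat).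

Local Notation "x ≼ y" := (P (x^-1 * y)) (at level 70).
Local Notation "x ≼R y" := (P (y * x^-1)) (at level 70).
Local Notation moves := (moves P D).

Let P1 := gP1 gar.
Let PD := gDP gar.
Let PM := gPM gar.
Let ple_trans := ple_trans gar.

Variables (X a b x1 x2 : G).
Hypotheses (atom_a : atom a) (atom_b : atom b) (a_X : a ≼ X) (X_notsimple : ~ X ≼ D).
Hypothesis X_prefix : forall w s, P w -> ~ D ≼ X * w -> s ≼ D -> s ≼ X * w -> s ≼ a.
Hypothesis X_suffix : forall k s, s ≼ D -> s ≼R X ^+ k.+1 -> s ≼R a.
Hypotheses (pos_x1 : P x1) (pos_x2 : P x2) (X_factor : X = x1 * (D * b^-1) * x2).

Let pos_a : P a := gatomP gar atom_a.

Lemma axis_pos : P X.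
Proof. exact: (ple_pos gar pos_a a_X). Qed.
Let pos_X := axis_pos.

Lemma axis_posX k : P (X ^+ k).
Proof. by elim: k => [|k IH]; rewrite ?expgS //; apply: PM. Qed.

Lemma axis_not_moves : ~ moves X.
Proof.
move=> [_ [//|[u h]]]; rewrite X_factor in h.
have pb : P (D * b^-1) by apply/(ple_sle_D gar)/(gatomD gar).
exact: (absorbs_coatom gar atom_b (absorbs_factor gar pos_x1 pb pos_x2 h)).
Qed.

Lemma atom_mul_notsimple : ~ a * a ≼ D.
Proof. exact: (gatom_sq gar atom_a). Qed.

Lemma sup_ex u : P u -> u <> 1 -> exists2 k, u ≼ D ^+ k.+1 & ~ u ≼ D ^+ k.
Proof.
move=> pu u1; have [k /asboolP hk kmin] := ex_minnP (let: ex_intro k h := ple_DX_ex gar u in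
  ex_intro (fun k => `[< u ≼ D ^+ k >]) k (asboolT h)).
case: k hk kmin => [|k] hk kmin; first by case: u1; apply: (pos_anti gar pu hk).
exists k => // h; by have := kmin k (asboolT h); rewrite ltnn.
Qed.

(* Since the last factor of [X] is the atom [a], a suffix [x] of [X] satisfies
   [sup (x a) = sup x + 1]. *)
Lemma axis_suffix_sup x k : P x -> x ≼R X -> x * a ≼ D ^+ k.+1 -> x ≼ D ^+ k.
Proof.
move=> px xX xa; have [s [sh sD smax]] := smeet_ex gar (x * a) D.
have as' : a ≼R s.
  apply: smax; first by rewrite mulgK.
  by apply/(ple_sle_D gar)/(gatomD gar).
have e : s = a; last by have := sle_greedy gar xa sh sD smax; rewrite e mulgK.
(* The quotient [s * a^-1] is a simple suffix of [X], hence 1 or [a]; the value [a] would make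
   [a * a] simple. *)
have sx : P (x * (s * a^-1)^-1) by rewrite invgM invgK mulgA.
have {}sD := (ple_sle_D gar s).2 sD.
have sa : s * a^-1 ≼R a.
  apply: (@X_suffix 0).
    by apply: ple_trans sD; rewrite invgM invgK -mulgA mulVg mulg1.
  by rewrite -(mulgVK x X) -mulgA; apply: PM.
have [e|e] := sle_atom gar atom_a as' sa.
  by apply: (mulIg a^-1); rewrite e mulgV.
by case: atom_mul_notsimple; rewrite -{1}e mulgVK.
Qed.

(** After removing the gcd of [p] and [X], a leftover [x] of [X] faces a leftover [p'] of [p]. If
    [p'] is trivial, the second copy of [X] is a factor of [y], which [axis_not_moves] forbids. *)
Lemma axis_pull1 p y w : P p -> P w -> moves y -> ~ D ≼ p * y ->
  p * y = X * (X * w) -> X ≼ p.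
Proof.
move=> pp pw my Dpy e; have [py _] := my.
have [d [dp dX dmax]] := meet_ex gar p X.
have pd : P d by apply/(ple1 P d)/dmax; rewrite invg1 mul1g.
set x := d^-1 * X; set p' := d^-1 * p.
have [x_1|x_1] := EM (x = 1).
  by move: x_1 dp => /(congr1 (fun g => d * g)); rewrite mulVKg mulg1 => ->.
have ey : p' * y = x * (X * w) by rewrite /p' /x -!mulgA e.
have Dq : ~ D ≼ X * w by move=> h; apply: Dpy; rewrite e; apply: (ple_D_mull gar).
have [p'_1|/(gatom_ex gar dp)[t at' tp]] := EM (p' = 1).
  have {}ey : y = x * X * w by rewrite -mulgA -ey p'_1 mul1g.
  by case: axis_not_moves; apply: (moves_factor gar dX pos_X pw); rewrite -ey.
(* The join of [x] and the atom [t] exceeds [x] by an atom dividing [X * w], necessarily [a]. But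
   [x * a] needs one more power of [D] than [x], whereas the join lies below every positive power of
   [D] bounding [x]. *)
exfalso; have [j [xj tj jmax]] := join_ex gar x t.
have jq : j ≼ x * (X * w).
  apply: jmax; first by rewrite mulKg; apply: PM.
  by rewrite -ey; apply: ple_trans tp _; rewrite mulKg.
have [xj1|/(gatom_ex gar xj)[a' aa' a'j]] := EM (x^-1 * j = 1).
  have jx : j = x by move: xj1 => /(congr1 (fun g => x * g)); rewrite mulVKg mulg1.
  have : d * t ≼ d.
    apply: dmax.
      by rewrite -(mulVKg d p); apply/ple_mul2l.
    by rewrite -(mulVKg d X); apply/ple_mul2l; rewrite -/x -jx.
  rewrite -{2}(mulg1 d) => /ple_mul2l /(pos_anti gar (gatomP gar at')) t1.
  by have := gatom_deg gar at'; rewrite t1 (deg1 gar).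
have a'X : a' ≼ X * w.
  by apply: ple_trans a'j _; rewrite invgM invgK -mulgA.
have [ea|ea] := ple_atom gar atom_a (gatomP gar aa') (X_prefix pw Dq (gatomD gar aa') a'X).
  by have := gatom_deg gar aa'; rewrite ea (deg1 gar).
subst a'; have xaj : x * a ≼ j by rewrite -(mulVKg x j); apply/ple_mul2l.
have [k xk nxk] := sup_ex dX x_1.
apply: nxk; apply: axis_suffix_sup dX _ _.
  by rewrite /x invgM invgK mulgA mulgV mul1g.
apply: ple_trans xaj _; apply: jmax => //.
by apply: ple_trans (gatomD gar at') _; apply: (ple_DX gar (isT : (1 <= k.+1)%N)).
Qed.

Lemma axis_pull k p y w : P p -> P w -> moves y -> ~ D ≼ p * y ->
  p * y = X ^+ k.+1 * w -> X ^+ k ≼ p.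
Proof.
elim: k p w => [|k IH] p w pp pw my Dpy e; first by rewrite invg1 mul1g.
have Xp : X ≼ p.
  apply: (axis_pull1 (w := X ^+ k * w) pp _ my Dpy); first by apply: PM => //; apply: axis_posX.
  by rewrite e !expgS -!mulgA.
rewrite expgS -(mulVKg X p); apply/ple_mul2l; apply: (IH _ w) => //.
  by move=> h; apply: Dpy; rewrite -(mulVKg X p) -mulgA; apply: (ple_D_mull gar).
by rewrite -mulgA e expgS -mulgA mulKg.
Qed.

Lemma moves_split z z1 z2 : P z1 -> P z2 -> z = z1 * z2 -> moves z -> moves z1 /\ moves z2.
Proof.
move=> h1 h2 -> mz; split.
  by apply: (moves_factor gar P1 h1 h2); rewrite mul1g.
by apply: (moves_factor gar h1 h2 P1); rewrite mulg1.
Qed.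

(** The part [z1] of [z] that creates [D ^+ m] is split off; since it divides that power, the
    remaining [p] is a prefix of [v], and [axis_pull] applies to [p]. *)
Lemma axis_forward k m v w z : P v -> P w -> ~ D ≼ X ^+ k.+1 * w -> moves z ->
  v * z = X ^+ k.+1 * w * D ^+ m -> X ^+ k ≼ v.
Proof.
move=> pv pw Dw mz e; have [pz _] := mz.
have pXw : P (X ^+ k.+1 * w) by apply: PM => //; apply: axis_posX.
have Dvz : D ^+ m ≼ v * z by rewrite e; apply/(conjDXs gar); rewrite mulgK.
have [z1 [z2 [p [ez [pz1 pz2] ep pp z1D]]]] := split_top gar pv pz Dvz.
have [_ mz2] := moves_split pz1 pz2 ez mz.
have my := moves_conjDX gar m mz2.
have epy : p * (D ^+ m * z2 * D ^- m) = X ^+ k.+1 * w.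
  by apply: (mulIg (D ^+ m)); rewrite -e ez (mulgA v) ep -!mulgA mulVg mulg1.
have pleft : p ≼ v.
  have -> : v = p * (D ^+ m * z1^-1) by rewrite mulgA -ep mulgK.
  by rewrite mulKg; apply/(ple_sle_DX gar).
by apply: ple_trans pleft; apply: (axis_pull pp pw my _ epy); rewrite epy.
Qed.

(* If [D] divides [X ^ k v], then the first factor of [v] is the complement of
   the atom [a]; in particular [a] does not divide [v]. *)
Lemma axis_top_mul k v : P v -> ~ D ≼ v -> D ≼ X ^+ k.+1 * v -> ~ a ≼ v.
Proof.
move=> pv Dv h av; have [q [qv qD qmax]] := meet_ex gar v D.
have pq : P q by apply/(ple1 P q)/qmax; rewrite invg1 mul1g.
have sD : P (D * q^-1) by apply/(ple_sle_D gar).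
have Dq : P (X ^+ k.+1 * (D * q^-1)^-1).
  rewrite invgM invgK mulgA; apply/(conjDs gar).
  have := qmax ((X ^+ k.+1)^-1 * D); rewrite !invgM !invgK -!mulgA; apply=> //.
  by apply/(conjDs gar); rewrite mulgK; apply: axis_posX.
have qs : D * q^-1 ≼ D by apply/(ple_sle_D gar); rewrite invgM invgK mulgA; apply: (gPDr gar).
have [e|e] := sle_atom gar atom_a sD (X_suffix qs Dq).
  by apply: Dv; have -> : D = q by apply: (mulIg q^-1); rewrite e mulgV.
have aq : a ≼ q by apply: qmax => //; apply: (gatomD gar).
have eD : D = a * q by rewrite -e mulgVK.
by apply: atom_mul_notsimple; rewrite eD invgM -mulgA mulKg.
Qed.

(** Only the last copy of [X], inside [w1], is multiplied by [z]. Unless the other copies create a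
    further [D], they persist as a prefix of [v]. *)
Lemma axis_backward k m v w z : P v -> ~ D ≼ v -> P w -> ~ D ≼ X ^+ k.+1 * w -> moves z ->
  X ^+ k.+1 * w * z = v * D ^+ m -> X ^+ k ≼ v.
Proof.
case: k => [|k] pv Dv pw Dw mz e; first by rewrite invg1 mul1g.
have [pz _] := mz; set w1 := X * w.
have pw1 : P w1 by apply: PM.
have Dw1 : ~ D ≼ w1.
  by move=> h; apply: Dw; rewrite expgSr -mulgA; apply: (ple_D_mull gar) => //; apply: axis_posX.
have [m' [v1 [e1 pv1 Dv1]]] := inf_ex gar (PM pw1 pz).
have e2 : X ^+ k.+1 * v1 * D ^+ m' = v * D ^+ m.
  by rewrite -e (expgSr X k.+1) -!mulgA -e1 /w1 -!mulgA.
have pX1 : P (X ^+ k.+1 * v1) by apply: PM => //; apply: axis_posX.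
have [h|h] := EM (D ≼ X ^+ k.+1 * v1); last first.
  by have [_ <-] := inf_uniq gar pX1 pv h Dv e2; rewrite mulKg.
(* Now [a] does not divide [v1], although [a] is the only possible first atom of [p], a common
   prefix of [w1] and [v1]. So [p] is trivial and [z1] completes [w1] to a power of [D]. *)
exfalso; have nav1 := axis_top_mul pv1 Dv1 h.
have Dw1z : D ^+ m' ≼ w1 * z by rewrite e1; apply/(conjDXs gar); rewrite mulgK.
have [z1 [z2 [p [ez [pz1 pz2] ep pp z1D]]]] := split_top gar pw1 pz Dw1z.
have [mz1 _] := moves_split pz1 pz2 ez mz.
have p_v1 : p ≼ v1.
  have -> : v1 = p * (D ^+ m' * z2 * D ^- m').
    by apply: (mulIg (D ^+ m')); rewrite -e1 ez (mulgA w1) ep -!mulgA mulVg mulg1.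
  by rewrite mulKg; apply/(conjDXV gar).
have p1 : p = 1.
  have [//|/(gatom_ex gar pp)[t at' tp]] := EM (p = 1).
  have tw : t ≼ w1.
    apply: ple_trans tp _; have -> : w1 = p * (D ^+ m' * z1^-1) by rewrite mulgA -ep mulgK.
    by rewrite mulKg; apply/(ple_sle_DX gar).
  have [et|et] := ple_atom gar atom_a (gatomP gar at') (X_prefix pw Dw1 (gatomD gar at') tw).
    by have := gatom_deg gar at'; rewrite et (deg1 gar).
  by case: nav1; rewrite -et; apply: ple_trans p_v1.
have {}ep : w1 * z1 = D ^+ m' by rewrite ep p1 mul1g.
have w1D : w1 ≼ D ^+ m' by rewrite -ep mulKg.
have XD l : w1 ≼ D ^+ l -> (l <= 1)%N -> False.
  move=> wl l1; apply: X_notsimple.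
  apply: (ple_trans (y := w1)); first by rewrite mulKg.
  by apply: ple_trans wl _; apply: (ple_DX gar l1).
case: m' ep w1D {e1 e2 Dw1z z1D} => [|m'] ep w1D; first exact: XD w1D _.
case: mz1 => _ [z1D|[u habs]].
  case: m' ep w1D => [|m'] ep w1D; first exact: XD w1D _.
  apply: Dw1; have -> : w1 = D ^+ m'.+1 * (D * z1^-1).
    by rewrite mulgA -expgSr -ep mulgK.
  rewrite expgS -mulgA mulKg; apply: PM; first exact: (posDX gar).
  exact/(ple_sle_D gar).
have aw : a ≼ w1 by apply: ple_trans a_X _; rewrite mulKg.
have := ple_greedy gar w1D aw (gatomD gar atom_a) (fun s sw sD => X_prefix pw Dw1 sD sw).
set g := a^-1 * w1 => gD; set r := g^-1 * D ^+ m' in gD.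
set c := D^-1 * (D ^- m' * a * D ^+ m') * D.
have ac : atom c by apply/(atom_conj gar)/(atom_conjX gar).
have ez1 : z1 = r * (D * c^-1) * 1.
  have ec : D * c^-1 = D ^- m' * (a^-1 * D ^+ m'.+1).
    by rewrite /c !invgM !invgK expgSr -!mulgA mulVKg.
  have er : r * (D * c^-1) = w1^-1 * D ^+ m'.+1.
    by rewrite ec /r /g invgM invgK -!mulgA !mulVKg.
  by rewrite mulg1 er -ep mulKg.
rewrite ez1 in habs.
have pc : P (D * c^-1) by apply/(ple_sle_D gar)/(gatomD gar).
exact: (absorbs_coatom gar ac (absorbs_factor gar gD pc P1 habs)).
Qed.

End Axis.

(** * Normal forms *)

Section IntegerPowers.
Variable G : groupType.
Implicit Types (x y : G) (k l : int).

Lemma zpow_sub x (m l : nat) : zpow x (m%:Z - l%:Z)%R = x ^+ m * x ^- l.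
Proof.
have [lm|ml] := leqP l m; first by rewrite subzn //= expgnFr.
have -> : (m%:Z - l%:Z)%R = Negz (l - m).-1 by lia.
rewrite /= prednK ?subn_gt0 // -{2}(subnKC (ltnW ml)) expgnDr.
by rewrite -expgnDr addnC expgnDr invgM mulVKg.
Qed.

Lemma int_subP k : exists m l : nat, k = (m%:Z - l%:Z)%R.
Proof. by case: k => m; [exists m, 0%N | exists 0%N, m.+1]; lia. Qed.

Lemma zpowD x k l : zpow x (k + l)%R = zpow x k * zpow x l.
Proof.
have [m [m' ->]] := int_subP k; have [q [q' ->]] := int_subP l.
have -> : (m%:Z - m'%:Z + (q%:Z - q'%:Z))%R = ((m + q)%:Z - (m' + q')%:Z)%R by lia.
have c : x ^- m' * x ^+ q = x ^+ q * x ^- m'.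
  by apply/commute_sym/commuteV/commuteX2/commute_refl.
by rewrite !zpow_sub expgnDr (addnC m') expgnDr invgM -!mulgA (mulgA (x ^- m')) c -!mulgA.
Qed.

Lemma zpow_nat x (m : nat) : zpow x m%:Z%R = x ^+ m.
Proof. by []. Qed.

Lemma zpow0 x : zpow x 0%R = 1.
Proof. by []. Qed.

Lemma zpowN x k : zpow x (- k)%R = (zpow x k)^-1.
Proof. by apply/esym/mulg1_eq; rewrite -zpowD subrr. Qed.

Lemma zpow_comm x k : commute (zpow x k) x.
Proof. by rewrite /commute -{2 3}(expg1 x) -(zpow_nat x 1) -!zpowD addrC. Qed.

End IntegerPowers.

(** * Attained extrema, as opposed to the default value 0 *)

Lemma int_set_max (A : set int) (B : int) : (exists k, A k) -> (forall k, A k -> (k <= B)%R) ->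
  A (set_max 0%R A) /\ forall k, A k -> (k <= set_max 0%R A)%R.
Proof.
move=> [k0 Ak0] AB.
have Qex : exists q : nat, `[< A (B - q%:Z)%R >].
  exists `|B - k0|%N; apply/asboolP.
  have -> : (B - `|B - k0|%N%:Z)%R = k0 by have := AB _ Ak0; lia.
  exact: Ak0.
have [q /asboolP Aq qmin] := ex_minnP Qex.
have qmax k : A k -> (k <= B - q%:Z)%R.
  move=> Ak; have kB := AB _ Ak; have /qmin : `[< A (B - `|B - k|%N%:Z)%R >].
    by apply/asboolP; have -> : (B - `|B - k|%N%:Z)%R = k by lia.
  by lia.
rewrite /set_max; case: xgetP => [y -> [Ay hy]|/(_ (B - q%:Z)%R)]; first by split.
by case; split.
Qed.

Lemma int_set_min (A : set int) (B : int) : (exists k, A k) -> (forall k, A k -> (B <= k)%R) ->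
  A (set_min 0%R A) /\ forall k, A k -> (set_min 0%R A <= k)%R.
Proof.
move=> [k0 Ak0] AB.
have Qex : exists q : nat, `[< A (B + q%:Z)%R >].
  exists `|k0 - B|%N; apply/asboolP.
  have -> : (B + `|k0 - B|%N%:Z)%R = k0 by have := AB _ Ak0; lia.
  exact: Ak0.
have [q /asboolP Aq qmin] := ex_minnP Qex.
have qmax k : A k -> (B + q%:Z <= k)%R.
  move=> Ak; have kB := AB _ Ak; have /qmin : `[< A (B + `|k - B|%N%:Z)%R >].
    by apply/asboolP; have -> : (B + `|k - B|%N%:Z)%R = k by lia.
  by lia.
rewrite /set_min; case: xgetP => [y -> [Ay hy]|/(_ (B + q%:Z)%R)]; first by split.
by case; split.
Qed.

Lemma nat_set_min (A : set nat) : (exists k, A k) -> A (set_min 0%N A).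
Proof.
move=> [k0 Ak0]; have Qex : exists q : nat, `[< A q >] by exists k0; apply/asboolP.
have [q /asboolP Aq qmin] := ex_minnP Qex.
rewrite /set_min; case: xgetP => [y -> []//|/(_ q)]; case; split=> // k Ak.
by rewrite leEnat; apply: qmin; apply/asboolP.
Qed.

Section NormalForms.
Variables (G : groupType) (P atom : set G) (D : G) (deg : G -> int).
Hypothesis gar : garside P atom D deg.
Implicit Types (x y z u v w t : G) (k m : nat) (s : seq G).

Local Notation "x ≼ y" := (P (x^-1 * y)) (at level 70).
Local Notation "x ≼R y" := (P (y * x^-1)) (at level 70).

Let P1 := gP1 gar.
Let PM := gPM gar.
Let ple_trans := ple_trans gar.

Lemma sle_trans y x z : x ≼R y -> y ≼R z -> x ≼R z.
Proof. by move=> xy yz; rewrite -(mulgVK y z) -mulgA; apply: PM. Qed.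

Lemma pos_prod s : (forall y, y \in s -> P y) -> P (\prod_(y <- s) y).
Proof.
elim: s => [_|y s IH h]; first by rewrite big_nil.
rewrite big_cons; apply: PM; first by apply: h; rewrite mem_head.
by apply: IH => z zs; apply: h; rewrite in_cons zs orbT.
Qed.

Lemma coatom_above b t : atom b -> b^-1 * D ≼ t -> t ≼ D -> t = b^-1 * D \/ t = D.
Proof.
move=> ab bt tD; have db := gatom_deg gar ab.
have := gdeg_ge0 gar bt; have := gdeg_ge0 gar tD.
rewrite !(gdegM gar) !(degV gar) !(gdegM gar) (degV gar) db => h1 h2.
have [e|e] := EM (deg t = deg D); [right | left].
  by apply: (ple_eq gar) => //; rewrite e.
by apply/esym; apply: (ple_eq gar bt); rewrite (gdegM gar) (degV gar) db; lia.
Qed.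

(* A left-weighted word ending in the complement [c] of an atom: a simple prefix
   of a multiple of it, multiplied step by step through the word, ends up in a
   simple multiple of [c], which can only be [c] or [D]. *)
Lemma weighted_prefix s c w t : s <> [::] -> (forall y, y \in s -> P y /\ y ≼ D) ->
  (forall i, (i.+1 < size s)%N -> forall e, e ≼ (nth 1 s i)^-1 * D -> e ≼ nth 1 s i.+1 -> e ≼ 1) ->
  last 1 s = c -> (forall j, c ≼ j -> j ≼ D -> j = c \/ j = D) ->
  P w -> ~ D ≼ (\prod_(y <- s) y) * w -> t ≼ D -> t ≼ (\prod_(y <- s) y) * w -> t ≼ head 1 s.
Proof.
elim: s t => // x s IH t _ simp lw lastc hc pw Dn tD tx.
have [px xD] := simp x (mem_head _ _).
have [j [tj xj jmax]] := join_ex gar t x.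
case: s IH simp lw lastc Dn tx => [|y s] IH simp lw lastc Dn tx.
  rewrite big_seq1 in Dn tx; move: lastc hc => /= <- hc.
  have jx : j ≼ x * w by apply: jmax => //; rewrite mulKg.
  have [e|e] := hc j xj (jmax _ tD xD); first by rewrite e in tj.
  by case: Dn; rewrite e in jx.
rewrite big_cons -mulgA in Dn tx.
set q := \prod_(_ <- _) _ * w in Dn tx.
have Dq : ~ D ≼ q by move=> h; apply: Dn; apply: (ple_D_mull gar).
have pq : P q by apply: PM => //; apply: pos_prod => z zs; case: (simp z) => //; rewrite in_cons zs orbT.
have jx : j ≼ x * q by apply: jmax => //; rewrite mulKg.
have jD := jmax _ tD xD.
have xjD : x^-1 * j ≼ x^-1 * D by rewrite invgM invgK -mulgA mulVKg.
have xjD' : x^-1 * j ≼ D.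
  by apply: ple_trans xjD _; rewrite invgM invgK; apply: (gPDl gar).
have xjq : x^-1 * j ≼ q by rewrite invgM invgK -mulgA.
have h : x^-1 * j ≼ y.
  apply: (IH (x^-1 * j)) => //.
  - by move=> z zs; apply: simp; rewrite in_cons zs orbT.
  - by move=> i si; apply: (lw i.+1).
have := lw 0%N isT _ xjD h; rewrite invgM invgK mulg1 => jx1.
exact: ple_trans tj jx1.
Qed.

(** The mirror argument, joining with the last factor and peeling it off. The condition on [u] times
    the first factor lets [u] be a previous power of [X]. *)
Lemma weighted_suffix s u t : P u -> s <> [::] -> (forall y, y \in s -> P y /\ y ≼ D) ->
  (forall i, (i.+1 < size s)%N -> forall e, e ≼R nth 1 s i -> e ≼R D * (nth 1 s i.+1)^-1 -> e ≼R 1) ->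
  (forall e, e ≼ D -> e ≼R u * head 1 s -> e ≼R head 1 s) ->
  t ≼ D -> t ≼R u * \prod_(y <- s) y -> t ≼R last 1 s.
Proof.
move=> pu; elim/last_ind: s t => // s y IH t _ simp rw base tD ty.
have [py yD] : P y /\ y ≼ D by apply: simp; rewrite mem_rcons mem_head.
case: (lastP s) IH simp rw base ty => [|s' x] IH simp rw base ty.
  by rewrite big_seq1 in ty; apply: base.
move: IH simp rw base ty; set s0 := rcons s' x => IH simp rw base ty.
have s0E : s0 <> [::] by move/(congr1 size); rewrite size_rcons.
clearbody s0.
have simp0 z : z \in s0 -> P z /\ z ≼ D by move=> zs; apply: simp; rewrite mem_rcons in_cons zs orbT.
rewrite last_rcons; have [j [tj yj jmax]] := sjoin_ex gar t y.
have tDR := (ple_sle_D gar t).1 tD; have yDR := (ple_sle_D gar y).1 yD.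
have jD := (ple_sle_D gar j).2 (jmax _ tDR yDR).
rewrite -cats1 big_cat big_seq1 mulgA in ty.
have jy : j ≼R u * (\prod_(z <- s0) z) * y.
  apply: jmax; first exact: ty.
  by rewrite mulgK; apply: PM => //; apply: pos_prod => z /simp0[].
have jyD : j * y^-1 ≼ D.
  by apply: ple_trans jD; rewrite invgM invgK -mulgA mulVg mulg1.
have h : j * y^-1 ≼R last 1 s0.
  apply: IH => //.
  - move=> i si e; have := rw i; rewrite size_rcons !nth_rcons si (ltnW si).
    by apply; apply: ltnW.
  - have hh : head 1 (rcons s0 y) = head 1 s0 by case: (s0) s0E.
    by rewrite hh in base.
  - by rewrite invgM invgK mulgA.
have s0n : (0 < size s0)%N by case: (s0) s0E.
have := rw (size s0).-1; rewrite size_rcons !nth_rcons prednK // ltnn eqxx !leqnn nth_last.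
move=> /(_ isT _ h); rewrite invgM invgK mul1g mulgA mulgVK => /(_ (jmax _ tDR yDR)) yj1.
exact: sle_trans tj yj1.
Qed.

End NormalForms.

(** * Projection to the axis *)

Section Projection.
Variables (G : groupType) (P atom : set G) (D : G) (deg : G -> int).
Hypothesis gar : garside P atom D deg.
Implicit Types (x y z u v w t g h : G) (k : nat) (l m : int).

Local Notation "x ≼ y" := (P (x^-1 * y)) (at level 70).
Local Notation "x ≼R y" := (P (y * x^-1)) (at level 70).
Local Notation moves := (moves P D).

Let P1 := gP1 gar.
Let PM := gPM gar.
Let ple_trans := ple_trans gar.

Variables (nf : seq G) (a b : G) (i0 : nat).
Hypotheses (atom_a : atom a) (atom_b : atom b).
Hypothesis nf_simple : forall y, y \in nf -> [/\ P y, y ≼ D & y <> 1].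
Hypothesis nf_left : forall i, (i.+1 < size nf)%N ->
  forall e, e ≼ (nth 1 nf i)^-1 * D -> e ≼ nth 1 nf i.+1 -> e ≼ 1.
Hypothesis nf_right : forall i, (i.+1 < size nf)%N ->
  forall e, e ≼R nth 1 nf i -> e ≼R D * (nth 1 nf i.+1)^-1 -> e ≼R 1.
Hypotheses (nf_head : head 1 nf = a) (nf_last : last 1 nf = a).
Hypotheses (i0_nf : (i0.+1 < size nf)%N) (nf_i0 : nth 1 nf i0 = b^-1 * D).
Let X := \prod_(y <- nf) y.
Hypothesis X_inf : ~ D ≼ X.

Let nf_simple2 y : y \in nf -> P y /\ y ≼ D.
Proof. by case/nf_simple. Qed.

(** The normal form is cut after the complement of [b]; the rest is merged into [w], so nothing is
    assumed on how [w] meets the last factor. *)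
Lemma nf_prefix w t : P w -> ~ D ≼ X * w -> t ≼ D -> t ≼ X * w -> t ≼ a.
Proof.
move=> pw; rewrite /X -(cat_take_drop i0.+1 nf) big_cat /= -mulgA.
have szt : size (take i0.+1 nf) = i0.+1 by rewrite size_takel // ltnW.
set r := \prod_(y <- drop _ _) y; move=> Dn tD tX.
have pr : P r by apply: (pos_prod gar) => y /mem_drop /nf_simple2[].
have -> : a = head 1 (take i0.+1 nf) by rewrite -nf_head; case: (nf).
apply: (weighted_prefix gar _ _ _ (erefl _) _ (PM pr pw) Dn tD tX).
- by move/(congr1 size); rewrite szt.
- by move=> y /mem_take /nf_simple2.
- move=> i; rewrite szt => si; rewrite !nth_take // ?(ltnW si) //.
  by apply: nf_left; apply: leq_trans si (ltnW i0_nf).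
move=> j; rewrite (last_nth 1).
have -> : nth 1 (1 :: take i0.+1 nf) (size (take i0.+1 nf)) = b^-1 * D.
  by rewrite szt /= nth_take.
exact: (coatom_above gar atom_b).
Qed.

(** Consecutive copies of [X] meet in [a] followed by [a]. Since [a * a] is not simple, a simple
    suffix cannot reach across this junction. *)
Lemma nf_suffix k t : t ≼ D -> t ≼R X ^+ k.+1 -> t ≼R a.
Proof.
have nf0 : nf <> [::] by move=> e; move: i0_nf; rewrite e.
have pX : P X by apply: (pos_prod gar) => y /nf_simple2[].
have pXk q : P (X ^+ q) by elim: q => // q IH; rewrite expgS; apply: PM.
elim: k t => [|k IH] t tD; rewrite expgSr -nf_last;
  apply: (weighted_suffix gar (pXk _) nf0 nf_simple2 nf_right) => //; rewrite nf_head.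
  by move=> e _; rewrite mul1g.
move=> e eD eX; have [j [ej aj jmax]] := sjoin_ex gar e a.
have jX := jmax _ eX (_ : a ≼R X ^+ k.+1 * a).
have {}jX : j ≼R X ^+ k.+1 * a by apply: jX; rewrite mulgK.
have aD : a ≼R D by apply/(ple_sle_D gar)/(gatomD gar).
have jD : j ≼ D by apply/(ple_sle_D gar)/jmax => //; apply/(ple_sle_D gar).
have jaD : j * a^-1 ≼ D.
  by apply: ple_trans jD; rewrite invgM invgK -mulgA mulVg mulg1; apply: (gatomP gar).
have jaX : j * a^-1 ≼R X ^+ k.+1 by rewrite invgM invgK mulgA.
have [ea|ea] := sle_atom gar atom_a aj (IH _ jaD jaX).
  by have <- : j = a by apply: (mulIg a^-1); rewrite ea mulgV.
by case: (gatom_sq gar atom_a); rewrite -{1}ea mulgVK.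
Qed.

Lemma nf_cons : exists y s, [/\ nf = a :: y :: s, P y, y <> 1 & P (\prod_(z <- s) z)].
Proof.
case E : nf i0_nf nf_head => [|x [|y s]] // _ /= ex; exists y, s.
have [py _ y1] : [/\ P y, y ≼ D & y <> 1] by apply: nf_simple; rewrite E !in_cons eqxx orbT.
split; rewrite ?ex //; apply: (pos_prod gar) => z zs.
by have [] := nf_simple (_ : z \in nf); rewrite // E !in_cons zs !orbT.
Qed.

Lemma nf_head_le : a ≼ X.
Proof.
have [y [s [e py _ ps]]] := nf_cons.
by rewrite /X e !big_cons mulKg; apply: PM.
Qed.

Lemma nf_notsimple : ~ X ≼ D.
Proof.
move=> XD; have [y [s [e py y1 ps]]] := nf_cons.
have /(ple_deg gar) : X ≼ a by apply: (nf_prefix P1); rewrite ?mulg1 // mulVg.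
have -> : deg X = (deg a + (deg y + deg (\prod_(z <- s) z)))%R.
  by rewrite /X e !big_cons !(gdegM gar).
have := gdeg_ge0 gar ps; have := gdeg_ge0 gar py.
have : deg y <> 0%R by move=> /(gdeg_eq0 gar py).
by lia.
Qed.

(** The complement of [b] is rewritten with its atom on the right, the side on which
    [absorbs_coatom] is stated; the atom becomes the conjugate of [b]. *)
Lemma nf_factor : exists x1 x2, [/\ P x1, P x2 & X = x1 * (D * (D^-1 * b * D)^-1) * x2].
Proof.
exists (\prod_(y <- take i0 nf) y), (\prod_(y <- drop i0.+1 nf) y); split.
- by apply: (pos_prod gar) => y /mem_take /nf_simple2[].
- by apply: (pos_prod gar) => y /mem_drop /nf_simple2[].
have -> : D * (D^-1 * b * D)^-1 = nth 1 nf i0.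
  by rewrite nf_i0 !invgM invgK mulVKg.
rewrite {1}/X -{1}(cat_take_drop i0 nf) big_cat /= -mulgA; congr (_ * _).
by rewrite (drop_nth 1) ?big_cons // ltnW.
Qed.

Let zD m := zpow D m.

Lemma commute_zpow m : commute (zD m) D.
Proof. exact: zpow_comm. Qed.

Lemma pos_conj_zpow m x : P (zD m * x * (zD m)^-1) <-> P x.
Proof.
case: m => k; first exact: (conjDXV gar).
by rewrite /zD /= invgK; apply: (conjDX gar).
Qed.

Lemma moves_conj_zpow m x : moves x -> moves (zD m * x * (zD m)^-1).
Proof. by apply: (moves_conj (commute_zpow m)); apply: pos_conj_zpow. Qed.

(* [axis_proj g k]: [X ^+ k] is a prefix of the representative with infimum
   0 of the coset of [g]. *)
Definition axis_proj g k := exists w m, [/\ P w, ~ D ≼ X ^+ k * w & g = X ^+ k * w * zD m].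

Lemma axis_proj_coset g k m : axis_proj g k -> axis_proj (g * zD m) k.
Proof.
move=> [w [l [pw Dw ->]]]; exists w, (l + m)%R; split=> //.
by rewrite /zD zpowD mulgA.
Qed.

Lemma inf_int_ex g : exists v m, [/\ P v, ~ D ≼ v & g = v * zD m].
Proof.
have [k pk] := gbound gar g; have [q [v [e pv Dv]]] := inf_ex gar pk.
exists (zD (- k%:Z)%R * v * (zD (- k%:Z)%R)^-1), (q%:Z - k%:Z)%R; split.
- exact/pos_conj_zpow.
- move=> h; apply: Dv; apply/(pos_conj_zpow (- k%:Z)%R); move: h; rewrite /zD.
  set c := zpow D _; have cD : commute c D by apply: commute_zpow.
  have -> : D^-1 * (c * v * c^-1) = c * (D^-1 * v) * c^-1 => //.
  by rewrite !mulgA; congr (_ * _ * _); apply/commute_sym/commuteV.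
rewrite /zD addrC zpowD -mulgA mulKg zpowN -mulgA -[zpow D q%:Z]/(D ^+ q) -e.
by rewrite mulKg.
Qed.

Lemma inf_int_nat p v m : P p -> ~ D ≼ v -> p = v * zD m -> exists k : nat, m = k%:Z%R.
Proof.
case: m => k pp Dv e; first by exists k.
case: Dv; have -> : v = p * D ^+ k * D by rewrite e /zD /= -mulgA -expgSr mulgVK.
by apply/(conjDs gar); rewrite mulgK; apply: PM => //; apply: (posDX gar).
Qed.

(** Conjugating [z] by a power of [D] collects the coset exponents at the end, where positivity
    makes their difference a natural number. The two orientations of the edge are the backward and
    forward lemmas. *)
Lemma axis_proj_step g h z k : moves z -> h = g * z \/ g = h * z -> axis_proj g k.+1 -> axis_proj h k.
Proof.
have [x1 [x2 [px1 px2 eX]]] := nf_factor.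
have ab' : atom (D^-1 * b * D) by apply: (atom_conj gar).
move=> mz gh [w [m [pw Dw eg]]]; have [v [l [pv Dv eh]]] := inf_int_ex h.
have pX : P X by apply: (pos_prod gar) => y /nf_simple2[].
have pXk q : P (X ^+ q) by elim: q => // q IH; rewrite expgS; apply: PM.
suff Xv : X ^+ k ≼ v by exists ((X ^+ k)^-1 * v), l; rewrite mulVKg.
have conjE x z' q : x * zD q * z' = x * (zD q * z' * (zD q)^-1) * zD q.
  by rewrite -!mulgA mulVg mulg1.
case: gh => e.
  have mz' := moves_conj_zpow m mz; have [pz' _] := mz'.
  have e1 : X ^+ k.+1 * w * (zD m * z * (zD m)^-1) = v * zD (l - m)%R.
    apply: (mulIg (zD m)); rewrite -conjE -eg -e eh -(mulgA v) /zD -zpowD; congr (_ * zpow D _).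
    by lia.
  have [q eq] : exists q : nat, (l - m)%R = q%:Z%R.
    by apply: (inf_int_nat _ Dv e1); apply: PM => //; apply: PM.
  rewrite eq in e1.
  exact: (axis_backward gar atom_a nf_head_le nf_notsimple nf_prefix nf_suffix pv Dv pw Dw mz' e1).
have mz' := moves_conj_zpow l mz; have [pz' _] := mz'.
have e1 : v * (zD l * z * (zD l)^-1) = X ^+ k.+1 * w * zD (m - l)%R.
  apply: (mulIg (zD l)); rewrite -conjE -eh -e eg -(mulgA (X ^+ k.+1 * w)) /zD -zpowD; congr (_ * zpow D _).
  by lia.
have [q eq] : exists q : nat, (m - l)%R = q%:Z%R.
  by apply: (inf_int_nat _ Dw e1); apply: PM.
rewrite eq in e1.
exact: (axis_forward gar atom_a ab' nf_head_le nf_notsimple nf_prefix nf_suffix px1 px2 eX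
  pv pw Dw mz' e1).
Qed.

(** If [D] divided a positive power of [X], it would be a suffix of the atom [a], against its degree
    being at least 2. *)
Lemma axis_proj_pow k : axis_proj (X ^+ k) k.
Proof.
exists 1, 0%R; rewrite !mulg1; split=> //.
case: k => [|k].
  by move=> /(ple_deg gar); rewrite (deg1 gar); have := gdegD gar; lia.
move=> /(conjDs gar) h; have DD : D ≼ D by rewrite mulVg.
have := gdeg_ge0 gar (nf_suffix DD h).
by rewrite (gdegM gar) (degV gar) (gatom_deg gar atom_a); have := gdegD gar; lia.
Qed.

Lemma axis_proj_top m k : ~ axis_proj (zD m) k.+1.
Proof.
move=> [w [l [pw Dw e]]].
have pX : P X by apply: (pos_prod gar) => y /nf_simple2[].
have pXk q : P (X ^+ q) by elim: q => // q IH; rewrite expgS; apply: PM.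
have {}e : zD (m - l)%R = X ^+ k.+1 * w.
  by apply: (mulIg (zD l)); rewrite -e /zD -zpowD; congr zpow; lia.
have pp : P (X ^+ k.+1 * w) by apply: PM.
have [q eq] : exists q : nat, (m - l)%R = q%:Z%R.
  apply: (@inf_int_nat (X ^+ k.+1 * w) 1); rewrite ?mul1g //.
  by move=> /(ple_deg gar); rewrite (deg1 gar); have := gdegD gar; lia.
case: q eq => [|q] eq; rewrite eq in e.
  apply: nf_notsimple; apply: (ple_trans (y := X ^+ k.+1 * w)).
    by rewrite expgS -mulgA mulKg; apply: PM.
  by rewrite -e /zD zpow0 invg1 mul1g; apply: (gDP gar).
by apply: Dw; rewrite -e /zD zpow_nat expgS mulKg; apply: (posDX gar).
Qed.

End Projection.

(** * The additional length graph *)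

Section AdditionalLengthGraph.
Variables (n : nat) (M : coxeterMatrix n).
Hypothesis sph : spherical M.
Local Notation G := (artin M).
Local Notation P := (positive M).
Local Notation D := (Delta M).
Local Notation gen := (gen M).
Implicit Types (x y z g h : G) (k l m : int) (v w : vertex M).

Let gar := Delta_garside sph.

Lemma adeg_zpow k : adeg (zpow D k) = (k * adeg D)%R.
Proof.
have [m [l ->]] := int_subP k.
by rewrite zpow_sub adegM (degV gar) !(degX gar) -!(mulr_natl (adeg D)) !natz mulrBl.
Qed.

Lemma ginf_spec x : pre_le (zpow D (ginf x)) x /\
  forall k, pre_le (zpow D k) x -> (k <= ginf x)%R.
Proof.
apply: (@int_set_max _ `|adeg x|%:Z%R).
  have [k hk] := gbound gar x; exists (- k%:Z)%R.
  by rewrite /pre_le /= zpowN invgK.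
move=> k /(gdeg_ge0 gar); rewrite adegM (degV gar) adeg_zpow.
have := gdegD gar; set d := adeg D; set e := adeg x; nia.
Qed.

Lemma gsup_spec x : pre_le x (zpow D (gsup x)) /\
  forall k, pre_le x (zpow D k) -> (gsup x <= k)%R.
Proof.
apply: (@int_set_min _ (- `|adeg x|%:Z)%R).
  by have [k hk] := ple_DX_ex gar x; exists k%:Z%R.
move=> k /(gdeg_ge0 gar); rewrite adegM (degV gar) adeg_zpow.
have := gdegD gar; set d := adeg D; set e := adeg x; nia.
Qed.

Lemma zpow_le k l : (k <= l)%R -> pre_le (zpow D k) (zpow D l).
Proof.
move=> kl; have -> : l = (k + `|l - k|%N%:Z)%R by lia.
by rewrite zpowD /pre_le mulKg; apply: (posDX gar).
Qed.

Lemma ginf_eq0 x : P x -> ~ pre_le D x -> ginf x = 0%R.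
Proof.
move=> px Dx; have [h1 h2] := ginf_spec x.
have h0 : (0 <= ginf x)%R by apply: h2; rewrite /pre_le invg1 mul1g.
apply/eqP; rewrite eq_le h0 andbT leNgt; apply/negP => h; apply: Dx.
by apply: (ple_trans gar (y := zpow D (ginf x))) => //; apply: (@zpow_le 1%R); lia.
Qed.

Lemma ginf0 x : ginf x = 0%R -> P x /\ ~ pre_le D x.
Proof.
move=> e; have [] := ginf_spec x; rewrite e => h1 h2; split.
  by move: h1; rewrite /pre_le invg1 mul1g.
by move=> h; have := h2 1%R h.
Qed.

Lemma absorbing_moves x y : P y -> ginf (x * y) = ginf x -> gsup (x * y) = gsup x ->
  moves P D y.
Proof.
move=> py ei es; split=> //; right.
have [i1 i2] := ginf_spec x; have [s1 s2] := gsup_spec (x * y).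
set u := (zpow D (ginf x))^-1 * x; exists u.
have zE : u * y = (zpow D (ginf x))^-1 * (x * y) by rewrite mulgA.
split=> //.
  have [_ i2'] := ginf_spec (x * y); move=> h.
  have : pre_le (zpow D (ginf x + 1)%R) (x * y).
    by rewrite zpowD /pre_le invgM -mulgA -zE.
  by move=> /i2'; rewrite ei; lia.
move=> q uq.
have [_ m2] := gsup_spec x.
have xq : pre_le x (zpow D (ginf x + q%:Z)%R).
  by rewrite zpowD; move: uq; rewrite /pre_le /u invgM invgK -mulgA.
have : pre_le (x * y) (zpow D (ginf x + q%:Z)%R).
  apply: (ple_trans gar (y := zpow D (gsup (x * y)))) => //.
  by apply: zpow_le; rewrite es; apply: m2.
by rewrite zpowD /pre_le /u -mulgA (invgM _ (x * y)) invgK -mulgA.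
Qed.

(** For supremum 0 the roles are exchanged: [y^-1] is positive and is absorbed by [x * y]. *)
Lemma absorbable_moves y : absorbable y -> moves P D y \/ moves P D y^-1.
Proof.
move=> [[e|e] [x [ei es]]].
  left; have [py _] := ginf0 e; exact: absorbing_moves es.
right; have [h _] := gsup_spec y; rewrite e in h.
have py : P y^-1 by move: h; rewrite /pre_le mulg1.
by apply: (@absorbing_moves (x * y)) => //; rewrite mulgK.
Qed.

Lemma vset_coset v g h : vset v g -> vset v h -> exists k, h = g * zpow D k.
Proof.
case: (vsetP v) => r -> [k ->] [l ->]; exists (l - k)%R.
by rewrite -mulgA -zpowD; congr (_ * zpow _ _); lia.
Qed.

Lemma vset_vertex_of g : vset (vertex_of g) g.
Proof. by exists 0%R; rewrite mulg1. Qed.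

Lemma vrepP v : vset v (vrep v).
Proof.
rewrite /vrep; case: xgetP => [y -> []//|none].
case: (vsetP v) => g vE.
have [y [m [py Dy e]]] := inf_int_ex gar g.
case: (none y); split; last exact: ginf_eq0.
by rewrite vE; exists (- m)%R; rewrite e -mulgA -zpowD subrr mulg1.
Qed.

Lemma AL_edge_moves v w : AL_edge v w -> exists g h,
  [/\ vset v g, vset w h & exists2 z, moves P D z & h = g * z \/ g = h * z].
Proof.
case=> [[s [[s1 sD] _ _ ws]]|[y [ay wy]]].
  exists (vrep v), (vrep v * s); split=> //; first exact: vrepP.
  exists s; last by left.
  by split; [move: s1; rewrite /pre_le invg1 mul1g | left].
exists (vrep v), (vrep v * y); split=> //; first exact: vrepP.
case: (absorbable_moves ay) => my; [exists y => //; by left | exists y^-1 => //; right].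
by rewrite mulgK.
Qed.

Lemma atom_conj_zpow (a : G) k : atoms M a -> atoms M ((zpow D k)^-1 * a * zpow D k).
Proof.
move=> /(atomP gar)[pa da]; apply/(atomP gar); split.
  by have := pos_conj_zpow gar (- k)%R a; rewrite zpowN invgK => ->.
by rewrite !adegM (degV gar) da; lia.
Qed.

Lemma AL_edge_gen g i : AL_edge (vertex_of g) (vertex_of (g * gen i)).
Proof.
left; have [k e] := vset_coset (vset_vertex_of g) (vrepP (vertex_of g)).
have aa : atoms M ((zpow D k)^-1 * gen i * zpow D k) by apply: atom_conj_zpow; exists i.
set s := _ * zpow D k in aa; have ds := gatom_deg gar aa.
have dD := gdegD gar.
exists s; split.
- by split; [rewrite /pre_le invg1 mul1g; apply: (gatomP gar) | apply: (gatomD gar)].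
- by move=> s1; move: ds; rewrite s1 (deg1 gar).
- by move=> sD; move: ds dD; rewrite -/D -{1}sD => ->.
by exists k; rewrite e /s -!mulgA mulVKg.
Qed.

(** An inverse atom becomes simple after multiplication by [Delta], which does not change the
    vertex. *)
Lemma AL_edge_genV g i : AL_edge (vertex_of g) (vertex_of (g * (gen i)^-1)).
Proof.
left; have [k e] := vset_coset (vset_vertex_of g) (vrepP (vertex_of g)).
have aa : atoms M ((zpow D k)^-1 * gen i * zpow D k) by apply: atom_conj_zpow; exists i.
set s := _ * zpow D k in aa; have ds := gatom_deg gar aa.
have dD := gdegD gar; have sD := gatomD gar aa.
exists (s^-1 * D); split.
- split; first by rewrite /pre_le invg1 mul1g.
  by rewrite /pre_le invgM invgK; apply/(gPDl gar)/(gatomP gar).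
- move=> e1; move: dD; rewrite -(mulVKg s D) adegM e1 (deg1 gar) ds; lia.
- move=> /(congr1 (@adeg n M)); rewrite adegM (degV gar) ds; lia.
exists (k + 1)%R; rewrite e /s !invgM invgK zpowD -!mulgA; congr (_ * _).
by rewrite mulVKg; congr (_ * _); apply: zpow_comm.
Qed.

Lemma AL_path_snoc v w w' (q : nat) : AL_path v w q -> AL_edge w w' -> AL_path v w' q.+1.
Proof.
move=> [p [p0 pq pe]] e; exists (fun i => if (i <= q)%N then p i else w'); split.
- by rewrite leq0n.
- by rewrite ltnn.
move=> i; rewrite ltnS => iq; rewrite iq; case: (ltnP i q) => [h|h]; first exact: pe.
have iE : i = q by lia.
by rewrite iE pq.
Qed.

(** [d_AL] takes the value 0 when no path exists, so the lower bound requires a path to [g]. *)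
Lemma AL_connected g : exists q, AL_path (vertex_of 1) (vertex_of g) q.
Proof.
rewrite -[g]word_classK; elim/last_ind: (repr g) => [|u [i e] [q IH]].
  exists 0%N, (fun _ => vertex_of 1); split=> //.
exists q.+1; apply: AL_path_snoc IH _; rewrite -cats1 word_class_cat.
by case: e; rewrite ?word_class_neg; [apply: AL_edge_genV | apply: AL_edge_gen].
Qed.

Lemma d_ALP g : AL_path (vertex_of 1) (vertex_of g) (d_AL (vertex_of 1) (vertex_of g)).
Proof. by apply: nat_set_min; apply: AL_connected. Qed.

End AdditionalLengthGraph.

(** * The lower bound *)

Section TranslationLength.
Variables (n : nat) (M : coxeterMatrix n).
Hypothesis sph : spherical M.
Local Notation G := (artin M).
Local Notation P := (positive M).
Local Notation D := (Delta M).
Implicit Types (x y z g h c : G) (v w : vertex M).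

Let gar := Delta_garside sph.

Variables (a b xG : G).
Hypotheses (atom_a : atoms M a) (atom_b : atoms M b) (hxG : xG_properties a b xG).

Let nf := left_nf xG.

(** The default of [left_nf] is the empty list, which [xG_factors] excludes by providing two
    entries. *)
Lemma left_nfP : is_left_nf xG nf.
Proof.
have [i + _] := xG_factors hxG; rewrite /nf /left_nf.
by case: xgetP => [y ->|].
Qed.

Lemma right_nfP : is_right_nf xG nf.
Proof.
have [i + _] := xG_factors hxG; rewrite /nf (xG_nf hxG) /right_nf.
by case: xgetP => [y ->|].
Qed.

Lemma xG_prod : xG = \prod_(y <- nf) y.
Proof. by have [_ e _ _ _] := left_nfP; rewrite {1}e (xG_inf hxG) zpow0 mul1g. Qed.

Lemma xG_simple y : y \in nf -> [/\ P y, pre_le y D & y <> 1].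
Proof.
have [_ _ h _ _] := left_nfP => /h[[y1 yD] yn1]; split=> //.
by move: y1; rewrite /pre_le invg1 mul1g.
Qed.

Lemma xG_left i : (i.+1 < size nf)%N ->
  forall e, pre_le e ((nth 1 nf i)^-1 * D) -> pre_le e (nth 1 nf i.+1) -> pre_le e 1.
Proof. by have [_ _ _ _ h] := left_nfP => /h[_ _ hi] e; apply: hi. Qed.

Lemma xG_right i : (i.+1 < size nf)%N ->
  forall e, P (nth 1 nf i * e^-1) -> P (D * (nth 1 nf i.+1)^-1 * e^-1) -> P (1 * e^-1).
Proof. by have [_ _ _ _ h] := right_nfP => /h[_ _ hi] e; apply: hi. Qed.

Lemma xG_head : head 1 nf = a.
Proof.
by have [<- _] := xG_ends hxG; rewrite /giota (xG_inf hxG) zpow0 conjg1.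
Qed.

Lemma xG_last : last 1 nf = a.
Proof. by have [_] := xG_ends hxG. Qed.

Lemma xG_not_top : ~ pre_le D xG.
Proof. by have [_] := ginf0 sph (xG_inf hxG). Qed.

Local Notation axis_proj := (axis_proj P D nf).

Lemma proj_step_xG g h z k : moves P D z -> h = g * z \/ g = h * z ->
  axis_proj g k.+1 -> axis_proj h k.
Proof.
have [i i_nf [nf_i _]] := xG_factors hxG.
have D_nf : ~ pre_le D (\prod_(y <- nf) y) by rewrite -xG_prod; apply: xG_not_top.
exact: (axis_proj_step gar atom_a atom_b xG_simple xG_left xG_right xG_head xG_last i_nf nf_i D_nf).
Qed.

Lemma proj_vertex c v g h k : vset v g -> vset v h -> axis_proj (c * g) k -> axis_proj (c * h) k.
Proof. by move=> vg vh; have [l ->] := vset_coset vg vh; rewrite mulgA; apply: axis_proj_coset. Qed.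

(** The part of adjacency that is visibly symmetric, so that a path can be followed backwards. *)
Definition joined v w := exists g h,
  [/\ vset v g, vset w h & exists2 z, moves P D z & h = g * z \/ g = h * z].

Lemma joined_sym v w : joined v w -> joined w v.
Proof.
move=> [g [h [vg wh [z mz e]]]]; exists h, g; split=> //; exists z => //.
by case: e; [right | left].
Qed.

(** Right multiplication along edges commutes with left translation by [c], so the translated path
    loses at most one copy of [xG] per edge. *)
Lemma proj_path c (p : nat -> vertex M) q k :
  (forall i, (i < q)%N -> joined (p i) (p i.+1)) ->
  (exists2 g, vset (p 0%N) g & axis_proj (c * g) (q + k)) ->
  exists2 h, vset (p q) h & axis_proj (c * h) k.
Proof.
elim: q k => [//|q IH] k pe p0.
have [||g vg pg] := IH k.+1.
- by move=> i iq; apply: pe; apply: ltnW.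
- by rewrite addnS -addSn.
have [g' [h [vg' vh [z mz e]]]] := pe q (ltnSn q).
exists h => //; apply: (proj_step_xG mz) (proj_vertex vg vg' pg).
by case: e => ->; [left | right]; rewrite mulgA.
Qed.

Lemma proj_path_length c (p : nat -> vertex M) q N :
  (forall i, (i < q)%N -> joined (p i) (p i.+1)) ->
  (exists2 g, vset (p 0%N) g & c * g = xG ^+ N) ->
  (exists2 h, vset (p q) h & c * h = 1) -> (N <= q)%N.
Proof.
move=> pe [g vg eg] [h vh eh]; rewrite leqNgt; apply/negP => qN.
have D_nf : ~ pre_le D (\prod_(y <- nf) y) by rewrite -xG_prod; apply: xG_not_top.
have [i i_nf [nf_i _]] := xG_factors hxG.
(* If [q < N], then [N - q] copies remain at the end; writing this number as a successor matches
   [axis_proj_top], which forbids any copy at the trivial vertex. *)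
have [|h' vh' ph'] := proj_path (c := c) (k := (N - q.+1).+1) pe.
  exists g => //; rewrite eg xG_prod.
  have -> : (q + (N - q.+1).+1 = N)%N by lia.
  exact: (axis_proj_pow gar atom_a xG_simple xG_right xG_head xG_last i_nf).
have := proj_vertex vh' vh ph'; rewrite eh -(zpow0 D).
exact: (axis_proj_top gar atom_b xG_simple xG_left xG_head i_nf nf_i D_nf).
Qed.

Theorem d_AL_axis N : (`|N| <= d_AL (vertex_of 1) (vertex_of (zpow xG N)))%N.
Proof.
have [p [p0 pq pe]] := d_ALP sph (zpow xG N); set q := d_AL _ _ in pq pe *.
have pj i : (i < q)%N -> joined (p i) (p i.+1) by move=> iq; apply: AL_edge_moves => //; apply: pe.
have v1 : vset (p 0%N) 1 by rewrite p0; apply: vset_vertex_of.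
have vN : vset (p q) (zpow xG N) by rewrite pq; apply: vset_vertex_of.
have [m [eN|eN]] : exists m : nat, N = m%:Z%R \/ N = (- m%:Z)%R by exists `|N|%N; lia.
  have -> : `|N|%N = m by rewrite eN.
  (* The path is reversed, because copies of [xG] are counted from the vertex that carries them down
     to the trivial one. *)
  apply: (@proj_path_length 1 (fun i => p (q - i)%N)).
  - move=> i iq; apply: joined_sym; have -> : (q - i = (q - i.+1).+1)%N by lia.
    by apply: pj; lia.
  - by exists (zpow xG N); rewrite ?subn0 // mul1g eN.
  - by exists 1; rewrite ?subnn // mul1g.
have -> : `|N|%N = m by rewrite eN; lia.
apply: (@proj_path_length (xG ^+ m) p _ _ pj).
- by exists 1; rewrite ?mulg1.
- by exists (zpow xG N) => //; rewrite eN zpowN mulgV.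
Qed.

End TranslationLength.

Local Open Scope ring_scope.

Theorem proposition3p10 (n : nat) (M : coxeterMatrix n)
    (hirr : irreducible M) (hsph : spherical M)
    (a b xG : artin M) (ha : atoms M a) (hb : atoms M b)
    (hxG : xG_properties a b xG) (N : int) :
  (`|N|%:~R / 2 <= (d_AL (vertex_of 1%g) (vertex_of (zpow xG N)))%:R :> rat).
Proof.
(* This gives the bound by the absolute value of [N] itself, twice what is claimed. *)
have h := d_AL_axis hsph ha hb hxG N.
apply: (@le_trans _ _ (`|N|%N%:R)); last by rewrite ler_nat.
rewrite -[`|N|]abszE -pmulrn.
have : (0 <= `|N|%N%:R :> rat) by rewrite ler0n.
by lra.
Qed.
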